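(* Let $m>1$ and let $(V_\delta,R_\delta,\sigma_\delta)_{0<\delta<1}$ be a high-energy family of solitary waves (as defined in the context) with associated parameters $\varepsilon_\delta,\mu_\delta$. Let $J_\delta:=[-\tfrac{1}{2\mu_\delta},\tfrac{1}{2\mu_\delta}]$ and $$\tilde W_\delta(\tilde x):=\frac{\mu_\delta}{\varepsilon_\delta}V_\delta\big(-\tfrac12+\mu_\delta\tilde x\big),\qquad \tilde W_0(\tilde x):=\tfrac12\big(\tilde S_0'(\tilde x)+\bar\mu\big).$$ Then there is a constant $C$ independent of $\delta$ such that $$\sup_{\tilde x\in J_\delta}\big|\tilde W_\delta(\tilde x)-\tilde W_0(\tilde x)\big|\le C\varepsilon_\delta^m,\qquad \sup_{\tilde x\in J_\delta}\big|\tilde W_\delta'(\tilde x)-\tilde W_0'(\tilde x)\big|\le C\varepsilon_\delta^{m+1}.$$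
   Context: Fix $m\in(1,\infty)$ and $\Phi(r)=\frac{1}{m(m+1)}\big((1-r)^{-m}-mr-1\big)$ for $r<1$. For $V\in L^2(\mathbb R)$ let $(AV)(x)=\int_{x-1/2}^{x+1/2}V(y)\,dy$. A solitary wave is a triple $(V,R,\sigma)$ with $\sigma>0$ satisfying $R=AV$ and $\sigma V=A\Phi'(R)$ on $\mathbb R$ (equivalently, for $V\in L^2$, $R'(x)=V(x+\frac12)-V(x-\frac12)$ and $\sigma V'(x)=\Phi'(R(x+\frac12))-\Phi'(R(x-\frac12))$ for all $x\in\mathbb R$). A function is unimodal if it is increasing for negative $x$ and decreasing for positive $x$. A high-energy family is a family $(V_\delta,R_\delta,\sigma_\delta)_{0<\delta<1}$ of solitary waves such that (i) $V_\delta,R_\delta\in L^2(\mathbb R)\cap BC^1(\mathbb R)$ are nonnegative, even and unimodal; (ii) $\|V_\delta\|_2=1-\delta$ and $R_\delta$ takes values in $[0,1)$; (iii) $p_\delta:=\int_{\mathbb R}\Phi(R_\delta(x))\,dx\to+\infty$ as $\delta\to0$. Its parameters are $\varepsilon_\delta:=1-R_\delta(0)$ and $\mu_\delta:=\sqrt{\sigma_\delta\,\varepsilon_\delta^{m+2}}$. $\tilde S_0:\mathbb R\to\mathbb R$ is the solution of $\tilde S_0''=\frac{2}{m+1}\,(1+\tilde S_0)^{-(m+1)}$, $\tilde S_0(0)=\tilde S_0'(0)=0$, and $\bar\mu:=\frac{2}{\sqrt{m(m+1)}}$. *)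

(* Defs.v *)
From HB Require Import structures.
From mathcomp Require Import all_boot all_order all_algebra.
From mathcomp Require Import all_classical all_reals all_analysis.

Set Implicit Arguments.
Unset Strict Implicit.
Unset Printing Implicit Defensive.

Import Order.TTheory GRing.Theory Num.Theory.
Import numFieldNormedType.Exports.

Local Open Scope ring_scope.
Local Open Scope classical_set_scope.

Section Definitions.
Context {R : realType}.
Local Notation leb := (@lebesgue_measure R).
Implicit Types (m sigma : R) (f V Rd : R -> R).

(* Meaningful for r < 1 only: powR takes conventional values on bases <= 0. *)
Definition Phi m (r : R) : R :=
  (m * (m + 1))^-1 * ((1 - r) `^ (- m) - m * r - 1).

Definition avg f (x : R) : R :=
  \int[leb]_(y in `[x - 1/2, x + 1/2]) f y.

Definition even_function f : Prop := forall x, f (- x) = f x.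

(* Monotonicity is understood in the weak sense. *)
Definition unimodal f : Prop :=
  {in `]-oo, 0[ &, nondecreasing_fun f} /\
  {in `]0, +oo[ &, nonincreasing_fun f}.

Definition BC1 f : Prop :=
  [/\ forall x, derivable f x 1, continuous (f^`()),
      bounded_fun f & bounded_fun (f^`())].

(* The distance profile is called Rd, since R is the field of reals.
   The condition Rd < 1 makes Phi'(Rd) meaningful. *)
Definition solitary_wave m V Rd sigma : Prop :=
  [/\ V \in Lfun leb 2%:E,
      0 < sigma,
      forall x, Rd x < 1,
      forall x, Rd x = avg V x &
      forall x, sigma * V x = avg (fun y => (Phi m)^`() (Rd y)) x].

Definition admissible_profile f : Prop :=
  [/\ f \in Lfun leb 2%:E, BC1 f, forall x, 0 <= f x,
      even_function f & unimodal f].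

(* The families are indexed by all reals, but only the members with index in
   ]0, 1[ are constrained.  In the last clause the integrand is nonnegative,
   and the limit is taken in \bar R. *)
Definition high_energy_family m (V Rd : R -> R -> R) (sigma : R -> R) : Prop :=
  (forall d, 0 < d < 1 ->
    [/\ solitary_wave m (V d) (Rd d) (sigma d),
        admissible_profile (V d) /\ admissible_profile (Rd d),
        'N[leb]_2%:E[EFin \o V d]%E = (1 - d)%:E &
        forall x, 0 <= Rd d x < 1]) /\
  (\int[leb]_x (Phi m (Rd d x))%:E)%E @[d --> 0^'+] --> +oo%E.

Definition eps_par (Rd : R -> R -> R) (d : R) : R := 1 - Rd d 0.

Definition mu_par m (Rd : R -> R -> R) (sigma : R -> R) (d : R) : R :=
  Num.sqrt (sigma d * eps_par Rd d `^ (m + 2)).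

(* The right-hand side of the equation is only defined where 1 + S0 > 0. *)
Definition is_S0 m (S0 : R -> R) : Prop :=
  [/\ forall x, derivable S0 x 1 /\ derivable (S0^`()) x 1,
      forall x, 0 < 1 + S0 x,
      forall x, S0^`(2) x = 2 / (m + 1) * (1 + S0 x) `^ (- (m + 1)),
      S0 0 = 0 & S0^`() 0 = 0].

Definition mubar m : R := 2 / Num.sqrt (m * (m + 1)).

Definition Wdelta m (V Rd : R -> R -> R) (sigma : R -> R) (d x : R) : R :=
  mu_par m Rd sigma d / eps_par Rd d
    * V d (- (1/2) + mu_par m Rd sigma d * x).

Definition W0 m (S0 : R -> R) (x : R) : R := 1/2 * (S0^`()%classic x + mubar m).

Definition Jdelta m (Rd : R -> R -> R) (sigma : R -> R) (d : R) : set R :=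
  `[- (1 / (2 * mu_par m Rd sigma d)), 1 / (2 * mu_par m Rd sigma d)].

End Definitions.

(* Main.v *)
(** With [eps = 1 - R(0)] and [1 - R (mu x) = eps (1 + S x)], the two advance-delay
    relations become [S'' = f(S) - O(eps^(m+1))] on [J], where [f] is the force
    of the equation for [S0]: the shifted terms only involve values of [Phi'] at
    arguments at most [R(1/2)], which the bound [||V||_2 <= 1] keeps away from 1.
    Both [S] and [S0] grow linearly, so [f'] decays along them and a weighted
    energy of [S - S0] stays of order [eps^(2(m+1))]; this controls [S - S0] by
    [eps^(m+1) (1 + x)^2] and [S' - S0'] by [eps^(m+1) (1 + x)].  Finally
    [W = (S' + E) / 2], where [E x = W x + W (- x)] is almost constant, and its
    value at the end of [J] is almost the asymptotic slope [mubar] of [S0].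
    On [J] one has [1 + x = O(1 / eps)] because [mu] is of order [eps].
    For [eps] bounded below, both sides are bounded. *)

Require Import Defs.
From HB Require Import structures.
From mathcomp Require Import all_boot all_order all_algebra.
From mathcomp Require Import all_classical all_reals all_analysis.
From mathcomp Require Import measurable_realfun ring lra.

Set Implicit Arguments.
Unset Strict Implicit.
Unset Printing Implicit Defensive.

Import Order.TTheory GRing.Theory Num.Theory.
Import numFieldNormedType.Exports.
Local Open Scope ring_scope.
Local Open Scope classical_set_scope.

(** * Mean value inequalities, primitives, window averages and unimodal functions *)

Section calculus.
Context {R : realType}.
Implicit Types (F G f g : R -> R) (a b x y : R).
Local Notation leb := (@lebesgue_measure R).

Lemma is_derive_continuous F a x : is_derive x 1 F a -> {for x, continuous F}.
Proof.
by move=> h; apply/differentiable_continuous/derivable1_diffP; apply: ex_derive.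
Qed.

Lemma is_derive_derive1 F a x : is_derive x 1 F a -> F^`() x = a.
Proof. by move=> h; rewrite derive1E derive_val. Qed.

Lemma MVT_is_derive F f a b : a <= b ->
  (forall x, a <= x <= b -> is_derive x 1 F (f x)) ->
  exists2 c, a <= c <= b & F b - F a = f c * (b - a).
Proof.
move=> ab dF; have [] := @MVT_segment R F f a b ab.
- by move=> x; rewrite in_itv/= => /andP[/ltW ax /ltW xb]; apply: dF; rewrite ax.
- apply: derivable_within_continuous => x; rewrite in_itv/= => xab.
  exact: (@ex_derive _ _ _ _ _ _ _ (dF x xab)).
- by move=> c; rewrite in_itv/= => cab E; exists c.
Qed.

Lemma le_is_derive F f G g a b : a <= b ->
  (forall x, a <= x <= b -> is_derive x 1 F (f x)) ->
  (forall x, a <= x <= b -> is_derive x 1 G (g x)) ->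
  (forall x, a <= x <= b -> f x <= g x) ->
  F b - F a <= G b - G a.
Proof.
move=> ab dF dG fg.
have [] := @MVT_is_derive (G - F) (fun x => g x - f x) a b ab.
  by move=> x xab; apply: is_deriveB; [exact: dG|exact: dF].
move=> c cab /= E.
have : 0 <= (g c - f c) * (b - a) by rewrite mulr_ge0// subr_ge0// fg.
by rewrite -E /= !fctE; lra.
Qed.

Lemma ge0_is_derive F f a b : a <= b ->
  (forall x, a <= x <= b -> is_derive x 1 F (f x)) ->
  (forall x, a <= x <= b -> 0 <= f x) -> F a <= F b.
Proof.
move=> ab dF f0; have := @le_is_derive (cst 0) (cst 0) F f a b ab.
by rewrite /= subrr subr_ge0; apply => // x _; exact: is_derive_cst.
Qed.

Lemma le0_is_derive F f a b : a <= b ->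
  (forall x, a <= x <= b -> is_derive x 1 F (f x)) ->
  (forall x, a <= x <= b -> f x <= 0) -> F b <= F a.
Proof.
move=> ab dF f0; have := @le_is_derive F f (cst 0) (cst 0) a b ab.
by rewrite /= subrr subr_le0; apply => // x _; exact: is_derive_cst.
Qed.

Lemma is_derive_affine F a b c x : is_derive (a + b * x) 1 F c ->
  is_derive x 1 (fun y => F (a + b * y)) (b * c).
Proof.
move=> dF.
have dl : is_derive x 1 (fun y => a + b * y) b.
  have := is_deriveD (is_derive_cst a x 1) (is_deriveZ b (is_derive_id x 1)).
  by rewrite add0r /GRing.scale/= mulr1; apply.
by have := @is_derive1_comp _ F (fun y => a + b * y) x c b dF dl; rewrite mulrC.
Qed.

Lemma continuous_itv_integrable f a b : continuous f ->
  leb.-integrable `[a, b] (EFin \o f).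
Proof.
move=> cf; apply: continuous_compact_integrable; first exact: segment_compact.
exact: continuous_subspaceT.
Qed.

(** The primitive is the integral from [a], hence a primitive only to the right of [a]. Later uses
    choose [a] to the left of every point in play. *)
Lemma continuous_antiderivative f a : continuous f ->
  exists F : R -> R, (forall x, a < x -> is_derive x 1 F (f x)) /\
   forall x y, a < x -> x <= y -> \int[leb]_(t in `[x, y]) f t = F y - F x.
Proof.
move=> cf; exists (fun x => \int[leb]_(t in `[a, x]) f t); split.
  move=> x ax; have xx1 : x < x + 1 by lra.
  have [|||d1 d2] := @continuous_FTC1 R f (BLeft a) x (x + 1) xx1.
  - exact: continuous_itv_integrable.
  - by rewrite /Order.lt/=.
  - exact: cf.
  - by apply: DeriveDef; [exact: d1|rewrite -derive1E; exact: d2].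
move=> x y ax xy; rewrite Rintegral_itvB ?bnd_simp ?(ltW ax)//; last first.
  exact: continuous_itv_integrable.
rewrite Rintegral_itv_obnd_cbnd//.
apply: integrableS (continuous_itv_integrable x y cf) => //.
by apply: subset_itvr; rewrite bnd_simp.
Qed.

Lemma avg_antiderivative f a : continuous f ->
  exists F : R -> R, (forall x, a < x -> is_derive x 1 F (f x)) /\
   forall x, a < x - 1/2 -> avg f x = F (x + 1/2) - F (x - 1/2).
Proof.
move=> /(@continuous_antiderivative f a)[F [dF iF]]; exists F; split=> // x ax.
by rewrite /avg iF//; lra.
Qed.

Lemma is_derive_avg f x : continuous f ->
  is_derive x 1 (avg f) (f (x + 1/2) - f (x - 1/2)).
Proof.
(* The base point [x - 2] lies to the left of every window centred within distance 1 of [x], so one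
   primitive serves a whole neighbourhood. *)
move=> cf; have [F [dF avgF]] := @avg_antiderivative f (x - 2) cf.
apply: (@near_eq_is_derive _ _ _ (fun y => F (1/2 + 1 * y) - F (- (1/2) + 1 * y))).
- near=> y; rewrite (mul1r y) avgF.
    by rewrite (addrC y) (addrC y).
  have : `|x - y| < 1 by near: y; apply: nbhsx_ballx.
  by rewrite ltr_norml => /andP[]; lra.
- apply: is_derive_eq.
  + apply: is_deriveB; apply: is_derive_affine; rewrite (mul1r x); apply: dF; lra.
  + by rewrite !(mul1r (f _)) !(addrC _ x).
Unshelve. all: by end_near. Qed.

(** Evenness reduces the claim to nonnegative arguments. Unimodality compares nonzero arguments
    only, so the value at 0 is reached as a limit from the right. *)
Lemma unimodal_antitone f x y : continuous f -> even_function f -> unimodal f ->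
  `|x| <= `|y| -> f y <= f x.
Proof.
move=> cf ef [_ df].
have efn z : f `|z| = f z by case: (ger0P z).
suff mono (u v : R) : 0 <= u -> u < v -> f v <= f u.
  rewrite -(efn x) -(efn y) le_eqVlt => /predU1P[->//|]; exact: mono.
rewrite le_eqVlt => /predU1P[u0|u0] uv; last first.
  by apply: df; rewrite ?inE/= ?in_itv/= ?andbT; lra.
rewrite -u0 in uv *.
have cv : f z @[z --> 0^'+] --> f 0 by apply: cvg_at_right_filter; exact: cf.
apply: (cvgr_to_ge cv).
near=> z; apply: df; rewrite ?inE/= ?in_itv/= ?andbT//.
apply: ltW; near: z; exact: nbhs_right_lt.
Unshelve. all: by end_near. Qed.

End calculus.

(** * Derivative rules in pointwise form *)

Section pointwise_derivatives.
Context {R : realType}.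
Implicit Types (F G : R -> R) (a b x : R).

Lemma is_deriveD_fun F G x a b : is_derive x 1 F a -> is_derive x 1 G b ->
  is_derive x 1 (fun y => F y + G y) (a + b).
Proof. exact: is_deriveD. Qed.

Lemma is_deriveB_fun F G x a b : is_derive x 1 F a -> is_derive x 1 G b ->
  is_derive x 1 (fun y => F y - G y) (a - b).
Proof. exact: is_deriveB. Qed.

Lemma is_deriveM_fun F G x a b : is_derive x 1 F a -> is_derive x 1 G b ->
  is_derive x 1 (fun y => F y * G y) (F x * b + G x * a).
Proof. exact: is_deriveM. Qed.

Lemma is_deriveZ_fun F k x a : is_derive x 1 F a ->
  is_derive x 1 (fun y => k * F y) (k * a).
Proof. exact: is_deriveZ. Qed.

Lemma is_derive_sqr_fun F x a : is_derive x 1 F a ->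
  is_derive x 1 (fun y => F y ^+ 2) (2 * F x * a).
Proof.
move=> dF; have := is_deriveM_fun dF dF.
rewrite (_ : F x * a + F x * a = 2 * F x * a); last by ring.
by rewrite (_ : (fun y => F y * F y) = (fun y => F y ^+ 2)).
Qed.

Lemma is_derive_powR_comp F p x a : 0 < F x -> is_derive x 1 F a ->
  is_derive x 1 (fun y => F y `^ p) (p * F x `^ (p - 1) * a).
Proof.
by move=> Fx dF; exact: (is_derive1_comp (@is_derive1_powR _ p _ Fx) dF).
Qed.

Lemma is_derive_expR_comp F x a : is_derive x 1 F a ->
  is_derive x 1 (fun y => expR (F y)) (expR (F x) * a).
Proof. by move=> dF; exact: (is_derive1_comp (is_derive_expR _) dF). Qed.

Lemma is_derive_onep x : is_derive x 1 (fun y : R => 1 + y) 1.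
Proof.
have := is_deriveD (is_derive_cst (1 : R) x 1) (is_derive_id x 1).
by rewrite add0r.
Qed.

Lemma is_derive_inv_onep x : 0 < 1 + x ->
  is_derive x 1 (fun y : R => (1 + y)^-1) (- ((1 + x)^-1 ^+ 2)).
Proof.
move=> x0; have := @is_deriveV _ (fun y : R => 1 + y) x 1 1 (lt0r_neq0 x0) (is_derive_onep x).
by rewrite /GRing.scale/= mulr1 exprVn.
Qed.

End pointwise_derivatives.

(** * The force of the limit equation and its potential *)

Section force.
Context {R : realType}.
Implicit Types m s t a : R.

Definition force m s : R := 2 / (m + 1) * (1 + s) `^ (- (m + 1)).

(** The primitive of [force m] that vanishes at 0. *)
Definition potential m s : R := 2 / (m * (m + 1)) * (1 - (1 + s) `^ (- m)).

Lemma is_derive_force m s : 1 < m -> 0 < 1 + s ->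
  is_derive s 1 (force m) (- (2 * (1 + s) `^ (- (m + 2)))).
Proof.
move=> hm s0; have := is_deriveZ_fun (2 / (m + 1))
  (@is_derive_powR_comp _ _ (- (m + 1)) _ _ s0 (is_derive_onep s)).
rewrite (_ : - (m + 1) - 1 = - (m + 2)); last by ring.
rewrite (_ : 2 / (m + 1) * _ = - (2 * (1 + s) `^ (- (m + 2)))) //.
field; rewrite !lt0r_neq0//; lra.
Qed.

Lemma is_derive_potential m s : 1 < m -> 0 < 1 + s -> is_derive s 1 (potential m) (force m s).
Proof.
move=> hm s0; have := is_deriveZ_fun (2 / (m * (m + 1))) (is_deriveB_fun (is_derive_cst (1 : R) s 1)
  (@is_derive_powR_comp _ _ (- m) _ _ s0 (is_derive_onep s))).
rewrite (_ : - m - 1 = - (m + 1)); last by ring.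
rewrite /force (_ : 2 / (m * (m + 1)) * _ = 2 / (m + 1) * (1 + s) `^ (- (m + 1))) //.
field; rewrite !lt0r_neq0//; lra.
Qed.

Lemma force_ge0 m s : 1 < m -> 0 <= force m s.
Proof. move=> hm; rewrite /force mulr_ge0 ?powR_ge0// divr_ge0//; lra. Qed.

Lemma force_gt0 m s : 1 < m -> 0 < 1 + s -> 0 < force m s.
Proof. move=> hm s0; rewrite /force mulr_gt0 ?powR_gt0// divr_gt0//; lra. Qed.

Lemma force_antitone m s t : 1 < m -> 0 < 1 + s -> s <= t -> force m t <= force m s.
Proof.
move=> hm s0 st; apply: (@le0_is_derive _ (force m) (fun z => - (2 * (1 + z) `^ (- (m + 2)))) _ _ st).
- by move=> z /andP[sz _]; apply: is_derive_force => //; lra.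
- by move=> z _; have := powR_ge0 (1 + z) (- (m + 2)); lra.
Qed.

Lemma force0 m : force m 0 = 2 / (m + 1).
Proof. by rewrite /force addr0 powR1 mulr1. Qed.

Lemma powRN_antitone p s t : 0 <= p -> 0 < s -> s <= t -> t `^ (- p) <= s `^ (- p).
Proof.
move=> p0 s0 st; rewrite !powRN lef_pV2 ?posrE ?powR_gt0//; last by lra.
by apply: ge0_ler_powR; rewrite ?nnegrE; lra.
Qed.

(** The derivative of the force decreases in modulus, so its value at the left end [a] bounds it on
    the whole half-line. *)
Lemma force_lipschitz m a s t : 1 < m -> 0 < 1 + a -> a <= s -> a <= t ->
  `|force m s - force m t| <= 2 * (1 + a) `^ (- (m + 2)) * `|s - t|.
Proof.
move=> hm a0; wlog st : s t / s <= t.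
  move=> H as_ at_; have [st|/ltW ts] := leP s t; first exact: H.
  by rewrite distrC (distrC s); exact: H.
move=> as_ at_.
have [|c /andP[sc ct] E] := @MVT_is_derive _ (force m) (fun z => - (2 * (1 + z) `^ (- (m + 2)))) s t st.
  by move=> z /andP[sz _]; apply: is_derive_force => //; lra.
rewrite distrC E normrM (distrC s) ler_wpM2r// normrN normrM ger0_norm//.
rewrite ger0_norm ?powR_ge0// ler_wpM2l// powRN_antitone//; lra.
Qed.

(** Explains [mubar]: a trajectory of zero energy has squared slope [2 * potential], which tends to
    [mubar m ^+ 2] as [s] grows. *)
Lemma potentialE m s : 1 < m -> 2 * potential m s = mubar m ^+ 2 * (1 - (1 + s) `^ (- m)).
Proof.
move=> hm; rewrite /mubar expr_div_n sqr_sqrtr; last by rewrite mulr_ge0//; lra.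
rewrite /potential; field; rewrite !lt0r_neq0//; lra.
Qed.

Lemma mubar_gt0 m : 1 < m -> 0 < mubar m.
Proof. move=> hm; rewrite /mubar divr_gt0 ?sqrtr_gt0 ?mulr_gt0//; lra. Qed.

Lemma potential_lt m s : 1 < m -> 0 < 1 + s -> 2 * potential m s < mubar m ^+ 2.
Proof.
move=> hm s0; rewrite potentialE// gtr_pMr ?exprn_gt0 ?mubar_gt0//.
by have := powR_gt0 (- m) s0; lra.
Qed.

End force.

(** * A priori bounds for almost solutions: slope, energy and linear growth *)

Section almost_solution.
Context {R : realType}.
Implicit Types (m X G x : R) (S T : R -> R).

(* [S1] and [S2] are the first two derivatives of [S], and [S] solves
   [S'' = force m S] on [[0, X]] up to a deficit between [0] and [G]. *)
Definition almost_solution m X G (S S1 S2 : R -> R) : Prop :=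
  [/\ S 0 = 0, S1 0 = 0 & forall x, 0 <= x <= X ->
    [/\ is_derive x 1 S (S1 x), is_derive x 1 S1 (S2 x), 0 <= S2 x
      & force m (S x) - G <= S2 x <= force m (S x)]].

Lemma almost_solutionW m X X' G G' S S1 S2 : X' <= X -> G <= G' ->
  almost_solution m X G S S1 S2 -> almost_solution m X' G' S S1 S2.
Proof.
move=> XX GG [S0 S10 dS]; split=> // x /andP[x0 xX].
have [|? ? ? /andP[? ?]] := dS x; first by rewrite x0; lra.
by split=> //; apply/andP; split=> //; lra.
Qed.

Variables (m X G : R) (S S1 S2 : R -> R).
Hypothesis hm : 1 < m.
Hypothesis hS : almost_solution m X G S S1 S2.

Lemma almost_solution_ge0 x : 0 <= x <= X -> 0 <= S x /\ 0 <= S1 x.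
Proof.
case: hS => S0 S10 dS.
have S1_ge0 y : 0 <= y <= X -> 0 <= S1 y.
  move=> /andP[y0 yX]; rewrite -S10; apply: (@ge0_is_derive _ _ S2) => // z /andP[z0 zy].
    by have [|] := dS z; first by apply/andP; split; lra.
  by have [|] := dS z; first by apply/andP; split; lra.
move=> /andP[x0 xX]; split; last by apply: S1_ge0; rewrite x0.
rewrite -S0; apply: (@ge0_is_derive _ _ S1) => // z /andP[z0 zx].
  by have [|] := dS z; first by apply/andP; split; lra.
by apply: S1_ge0; apply/andP; split; lra.
Qed.

(** Twice the mechanical energy. Its derivative is [2 * S1] times [S2 - force], which is nonpositive
    because the deficit is, and nonnegative when [G <= 0]; it starts from 0. *)
Let energy y := S1 y ^+ 2 - 2 * potential m (S y).

Let is_derive_energy x : 0 <= x <= X ->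
  is_derive x 1 energy (2 * S1 x * (S2 x - force m (S x))).
Proof.
move=> xX; case: hS => S0 S10 dS; have [dSx dS1x _ _] := dS _ xX.
have [Sx _] := almost_solution_ge0 xX.
have Sx1 : 0 < 1 + S x by lra.
have := is_deriveB_fun (is_derive_sqr_fun dS1x)
  (is_deriveZ_fun 2 (is_derive1_comp (is_derive_potential hm Sx1) dSx)).
by rewrite (_ : 2 * S1 x * (S2 x - _) = 2 * S1 x * S2 x - 2 * (force m (S x) * S1 x)) //; ring.
Qed.

Let energy0 : energy 0 = 0.
Proof.
have h := hm.
by case: hS => S0 S10 _; rewrite /energy S0 S10 potentialE// addr0 powR1; ring.
Qed.

Lemma almost_solution_energy_le x : 0 <= x <= X -> S1 x ^+ 2 <= 2 * potential m (S x).
Proof.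
move=> /andP[x0 xX]; rewrite -subr_le0 -energy0.
apply: (@le0_is_derive _ energy (fun z => 2 * S1 z * (S2 z - force m (S z)))) => // z /andP[z0 zx].
  by apply: is_derive_energy; apply/andP; split; lra.
have zX : 0 <= z <= X by apply/andP; split; lra.
have [_ Sz] := almost_solution_ge0 zX.
case: hS => _ _ /(_ z zX) [_ _ _ /andP[_ S2z]].
by rewrite mulr_ge0_le0//; lra.
Qed.

Lemma almost_solution_energy_ge x : G <= 0 -> 0 <= x <= X ->
  2 * potential m (S x) <= S1 x ^+ 2.
Proof.
move=> G0 /andP[x0 xX]; rewrite -subr_ge0 -energy0.
apply: (@ge0_is_derive _ energy (fun z => 2 * S1 z * (S2 z - force m (S z)))) => // z /andP[z0 zx].
  by apply: is_derive_energy; apply/andP; split; lra.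
have zX : 0 <= z <= X by apply/andP; split; lra.
have [_ Sz] := almost_solution_ge0 zX.
case: hS => _ _ /(_ z zX) [_ _ _ /andP[S2z _]].
by rewrite mulr_ge0//; lra.
Qed.

Lemma almost_solution_slope_le x : 0 <= x <= X -> S1 x <= mubar m.
Proof.
have h := hm; move=> xX; have [Sx S1x] := almost_solution_ge0 xX.
have Sx1 : 0 < 1 + S x by lra.
rewrite -(@ler_pXn2r _ 2)// ?nnegrE//; last by apply/ltW/mubar_gt0.
apply: (le_trans (almost_solution_energy_le xX)).
by apply/ltW/potential_lt.
Qed.

(** While [S <= 1/2] the force is at least [2 c]; a deficit of at most [c] still leaves an
    acceleration of at least [c]. *)
Let c := force m (1/2) / 2.
Hypothesis hG : G <= c.

Let c_gt0 : 0 < c.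
Proof. by rewrite /c divr_gt0// force_gt0//; lra. Qed.

Let c_le : c <= 1/2.
Proof.
have h := hm; rewrite /c; have := @force_antitone _ m 0 (1/2) h.
rewrite force0 => /(_ ltac:(lra) ltac:(lra)).
have : 2 / (m + 1) <= 1 by rewrite ler_pdivrMr; lra.
by move=> /[swap] /le_trans/[apply]; lra.
Qed.

(** The acceleration is at most [force m 0 = 2 / (m + 1) <= 1]; integrating twice gives [S1 x <= x]
    and [S x <= x^2 / 2]. *)
Lemma almost_solution_le_half x : 0 <= x <= X -> x <= 1 -> S x <= 1/2.
Proof.
have h := hm; move=> /andP[x0 xX] x1; case: hS => S0 S10 dS.
have S1_le y : 0 <= y -> y <= x -> S1 y <= y.
  move=> y0 yx; have := @le_is_derive _ S1 S2 id (cst 1) 0 y y0.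
  rewrite S10 !subr0 /=; apply=> z /andP[z0 zy].
    by have [|] := dS z; first by apply/andP; split; lra.
  have zX : 0 <= z <= X by apply/andP; split; lra.
  have [Sz _] := almost_solution_ge0 zX.
  have [_ _ _ /andP[_ S2z]] := dS z zX; apply: le_trans S2z _.
  apply: le_trans (@force_antitone _ m 0 (S z) h _ Sz) _; first by lra.
  by rewrite force0 ler_pdivrMr; lra.
have := @le_is_derive _ S S1 (fun y => 1/2 * y ^+ 2) id 0 x x0.
rewrite S0 subr0 expr0n/= mulr0 subr0 => /(_ _ _ _)/le_trans; apply.
- by move=> z /andP[z0 zx]; have [|] := dS z; first by apply/andP; split; lra.
- move=> z _; have := is_deriveZ_fun (1/2) (is_derive_sqr_fun (is_derive_id z (1:R))).
  by rewrite (_ : 1/2 * (2 * z * 1) = z) //; field.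
- by move=> z /andP[z0 zx]; apply: S1_le.
by nra.
Qed.

(** Up to time 1 the acceleration is at least [c]; afterwards the slope cannot decrease since
    [S2 >= 0]. *)
Lemma almost_solution_slope_ge x : 0 <= x <= X ->
  c * Num.min x 1 <= S1 x.
Proof.
have h := hm; case: hS => S0 S10 dS.
have A y : 0 <= y <= X -> y <= 1 -> c * y <= S1 y.
  move=> /andP[y0 yX] y1; have := @le_is_derive _ (fun z => c * z) (cst c) S1 S2 0 y y0.
  rewrite S10 mulr0 !subr0; apply=> z /andP[z0 zy].
  - by have := is_deriveZ_fun c (is_derive_id z (1:R)); rewrite mulr1.
  - by have [|] := dS z; first by apply/andP; split; lra.
  have zX : 0 <= z <= X by apply/andP; split; lra.
  have [Sz _] := almost_solution_ge0 zX.
  have [_ _ _ /andP[S2z _]] := dS z zX; apply: le_trans S2z.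
  have := @force_antitone _ m (S z) (1/2) h _ (almost_solution_le_half zX _).
  move=> /(_ ltac:(lra) ltac:(lra)); rewrite /= -/c.
  by have := hG; rewrite /c; lra.
move=> xX; rewrite minEle; case: ifPn => [|]; first exact: A.
rewrite -ltNge mulr1 => /ltW x1.
move/andP: xX => [x0 xX].
have := A 1; rewrite mulr1 => /(_ ltac:(by apply/andP; split; lra) ltac:(lra)) A1.
apply: (le_trans A1).
apply: (@ge0_is_derive _ S1 S2) => // z /andP[z1 zx].
  by have [|] := dS z; first by apply/andP; split; lra.
by have [|] := dS z; first by apply/andP; split; lra.
Qed.

(** Before time 1 the bound follows from [c <= 1/2] and [S >= 0]; after it, the slope bound [c] is
    integrated from 1. *)
Lemma almost_solution_growth x : 0 <= x <= X -> c * (1 + x) <= 1 + S x.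
Proof.
move=> xX; have [Sx _] := almost_solution_ge0 xX; case: hS => S0 S10 dS.
have c2 := c_le; have c0 := c_gt0.
have [x1|x1] := leP x 1.
  suff : c * (1 + x) <= 1 by lra.
  by nra.
have [x0 xX'] := andP xX.
have := @le_is_derive _ (fun z => c * z) (cst c) S S1 1 x (ltW x1).
have : 0 <= S 1 by apply: (almost_solution_ge0 _).1; apply/andP; split; lra.
move=> S11 /(_ _ _ _) H.
suff : c * x - c * 1 <= S x - S 1 by lra.
apply: H => z /andP[z1 zx].
- by have := is_deriveZ_fun c (is_derive_id z (1:R)); rewrite mulr1.
- by have [|] := dS z; first by apply/andP; split; lra.
have := @almost_solution_slope_ge z; rewrite min_r// mulr1; apply.
by apply/andP; split; lra.
Qed.

End almost_solution.

(** * Comparison of two almost solutions by a weighted energy *)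

Section comparison.
Context {R : realType}.
Implicit Types (m X G x : R) (S T : R -> R).

(** With [c = force m (1/2) / 2], the Lipschitz constant of the force where [1 + s >= c (1 + x)] is
    this number times [(1 + x)^-(m + 2)]. *)
Definition comparison_rate m : R := 2 * (force m (1/2) / 2) `^ (- (m + 2)).

Definition comparison_constant m : R := 2 * expR (comparison_rate m).

Lemma comparison_rate_ge0 m : 0 <= comparison_rate m.
Proof. by rewrite /comparison_rate mulr_ge0// powR_ge0. Qed.

(** Cubic decay is what the weighted energy can absorb: it leaves a growth rate of order
    [(1 + x)^-2], which is integrable on the half-line. *)
Lemma powRN_le_cube m x : 1 < m -> 0 <= x -> (1 + x) `^ (- (m + 2)) <= (1 + x)^-1 ^+ 3.
Proof.
move=> hm x0; rewrite exprVn -powR_invn; last by lra.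
by apply: ler_powR; lra.
Qed.

Lemma force_gap m X G S S1 S2 T T1 T2 x : 1 < m -> G <= force m (1/2) / 2 ->
  almost_solution m X G S S1 S2 -> almost_solution m X G T T1 T2 ->
  0 <= x <= X ->
  `|force m (S x) - force m (T x)| <=
     comparison_rate m * (1 + x) `^ (- (m + 2)) * `|S x - T x|.
Proof.
move=> hm hG hS hT xX; have [x0 _] := andP xX.
have := almost_solution_growth hm hS hG xX; have := almost_solution_growth hm hT hG xX.
rewrite /comparison_rate; have : 0 < force m (1/2) / 2.
  by rewrite divr_gt0// force_gt0//; lra.
move: (force m (1/2) / 2) => c c0 gT gS.
have cx : 0 < c * (1 + x) by rewrite mulr_gt0//; lra.
rewrite -(mulrA 2) -powRM; [|lra..].
(* By linear growth both solutions lie above [c * (1 + x) - 1]. *)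
have := @force_lipschitz _ m (c * (1 + x) - 1) (S x) (T x) hm.
rewrite (_ : 1 + (c * (1 + x) - 1) = c * (1 + x)); last by ring.
by apply; lra.
Qed.

(** Both deficits lie in [[0, G]], so their difference contributes [G] and not [2 G]. *)
Lemma second_derivative_gap m X G S S1 S2 T T1 T2 x :
  1 < m -> 0 <= G -> G <= force m (1/2) / 2 ->
  almost_solution m X G S S1 S2 -> almost_solution m X G T T1 T2 ->
  0 <= x <= X ->
  `|S2 x - T2 x| <= comparison_rate m * (1 + x)^-1 ^+ 3 * `|S x - T x| + G.
Proof.
move=> hm G0 hG hS hT xX; have [x0 _] := andP xX.
have gap := force_gap hm hG hS hT xX.
case: hS => _ _ /(_ x xX)[_ _ _ /andP[Sl Su]].
case: hT => _ _ /(_ x xX)[_ _ _ /andP[Tl Tu]].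
have : comparison_rate m * (1 + x) `^ (- (m + 2)) * `|S x - T x| <=
    comparison_rate m * (1 + x)^-1 ^+ 3 * `|S x - T x|.
  by rewrite ler_wpM2r// ler_wpM2l ?comparison_rate_ge0// powRN_le_cube.
move/(le_trans gap); move: gap => _.
rewrite !ler_norml => /andP[g1 g2]; apply/andP; split; lra.
Qed.

(* Here [v = 1 / (1 + x)], and [d0], [d1], [d2] are the difference of two
   almost solutions and its first two derivatives. *)
Lemma comparison_form (A G E v d0 d1 d2 : R) : 0 <= A -> 0 <= G -> 0 <= v ->
  0 <= E -> `|d2| <= A * v ^+ 3 * `|d0| + G ->
  (- v ^+ 2 * d1 ^+ 2 + 2 * v * d1 * d2 - 3 * v ^+ 4 * d0 ^+ 2 +
     2 * v ^+ 3 * d0 * d1) * E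
   - A * v ^+ 2 * (v * d1 ^+ 2 + v ^+ 3 * d0 ^+ 2) * E <= 2 * G ^+ 2 * E.
Proof.
move=> A0 G0 v0 E0 hd2.
rewrite -mulrBl ler_wpM2r//.
pose p := v * `|d1|; pose q := v ^+ 2 * `|d0|.
have p0 : 0 <= p by rewrite mulr_ge0.
have q0 : 0 <= q by rewrite mulr_ge0// exprn_ge0.
have t1 : v * d1 * d2 <= p * (A * v * q + G).
  apply: (le_trans (ler_norm _)); rewrite !normrM (ger0_norm v0) -/p ler_wpM2l//.
  by rewrite /q (_ : A * v * (v ^+ 2 * `|d0|) = A * v ^+ 3 * `|d0|) //; ring.
have t2 : v ^+ 3 * d0 * d1 <= q * p.
  apply: (le_trans (ler_norm _)); rewrite 2!normrM (ger0_norm (exprn_ge0 3 v0)) /p /q.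
  by rewrite le_eqVlt; apply/orP; left; apply/eqP; ring.
have e1 : v ^+ 2 * d1 ^+ 2 = p ^+ 2 by rewrite /p exprMn real_normK ?num_real.
have e2 : v ^+ 4 * d0 ^+ 2 = q ^+ 2.
  by rewrite /q exprMn real_normK ?num_real// -exprM.
have e3 : A * v ^+ 2 * (v * d1 ^+ 2 + v ^+ 3 * d0 ^+ 2) = A * v * (p ^+ 2 + q ^+ 2).
  by rewrite -e1 -e2; ring.
rewrite e3.
have Av : 0 <= A * v by rewrite mulr_ge0.
(* The cross term [2 A v p q] is absorbed by [A v (p^2 + q^2)]. The terms [2 p G] and [2 p q] each
   use half of [p^2], at the price of [2 G^2] and [2 q^2]; the latter is covered by [3 q^2]. *)
have h1 : 0 <= A * v * (p - q) ^+ 2 by rewrite mulr_ge0// sqr_ge0.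
have h2 : 0 <= (p - 2 * G) ^+ 2 by apply: sqr_ge0.
have h3 : 0 <= (p - 2 * q) ^+ 2 by apply: sqr_ge0.
have h4 : 0 <= q ^+ 2 by apply: sqr_ge0.
by nra.
Qed.

(** The product [Q * E] starts at 0 and grows at rate at most [B], while [E >= 1], so
    [Q x <= B (1 + x)]. Each of the two terms of [Q] then gives one estimate after a square root. *)
Lemma almost_solution_compare m X G S S1 S2 T T1 T2 x :
  1 < m -> 0 <= G -> G <= force m (1/2) / 2 ->
  almost_solution m X G S S1 S2 -> almost_solution m X G T T1 T2 ->
  0 <= x <= X ->
  `|S x - T x| <= comparison_constant m * G * (1 + x) ^+ 2 /\
  `|S1 x - T1 x| <= comparison_constant m * G * (1 + x).
Proof.
move=> hm G0 hG hS hT xX.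
pose A := comparison_rate m; have A0 : 0 <= A := comparison_rate_ge0 m.
(* Dominates the source term [2 G^2 E], since [v <= 1] gives [E <= expR A]. *)
pose B := 2 * expR A * G ^+ 2.
pose D y := S y - T y; pose D1 y := S1 y - T1 y; pose D2 y := S2 y - T2 y.
pose v (y : R) := (1 + y)^-1; pose E y := expR (A * v y).
(* [Z] is a Lyapunov function: the factor [E] absorbs the [A v^3 |D|] term. *)
pose Q y := v y * D1 y ^+ 2 + v y ^+ 3 * D y ^+ 2.
have dD (y : R) : 0 <= y <= X -> is_derive y 1 D (D1 y).
  move=> yX; case: hS => _ _ /(_ y yX) [dS _ _ _]; case: hT => _ _ /(_ y yX) [dT _ _ _].
  exact: is_deriveB_fun.
have dD1 (y : R) : 0 <= y <= X -> is_derive y 1 D1 (D2 y).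
  move=> yX; case: hS => _ _ /(_ y yX) [_ dS _ _]; case: hT => _ _ /(_ y yX) [_ dT _ _].
  exact: is_deriveB_fun.
have dv (y : R) : 0 <= y -> is_derive y 1 v (- v y ^+ 2).
  by move=> y0; apply: is_derive_inv_onep; lra.
have dE (y : R) : 0 <= y -> is_derive y 1 E (E y * (A * - v y ^+ 2)).
  by move=> y0; exact: is_derive_expR_comp (is_deriveZ_fun A (dv y y0)).
pose Z y := Q y * E y - B * (1 + y).
pose Z1 y := (- v y ^+ 2 * D1 y ^+ 2 + 2 * v y * D1 y * D2 y
   - 3 * v y ^+ 4 * D y ^+ 2 + 2 * v y ^+ 3 * D y * D1 y) * E y
   - A * v y ^+ 2 * (v y * D1 y ^+ 2 + v y ^+ 3 * D y ^+ 2) * E y - B.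
have dZ (y : R) : 0 <= y <= X -> is_derive y 1 Z (Z1 y).
  move=> yX; have [y0 _] := andP yX.
  have dv3 := is_deriveM_fun (dv y y0) (is_derive_sqr_fun (dv y y0)).
  have dQ := is_deriveD_fun (is_deriveM_fun (dv y y0) (is_derive_sqr_fun (dD1 y yX)))
    (is_deriveM_fun dv3 (is_derive_sqr_fun (dD y yX))).
  have := is_deriveB_fun (is_deriveM_fun dQ (dE y y0)) (is_deriveZ_fun B (is_derive_onep y)).
  rewrite (_ : _ - B * 1 = Z1 y); last by rewrite /Z1; ring.
  by rewrite (_ : (fun _ => _) = Z)//; apply/funext => z; rewrite /Z /Q exprS.
have v1 (y : R) : 0 <= y -> 0 <= v y <= 1.
  move=> y0; rewrite /v invr_ge0 invf_le1; last by lra.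
  by apply/andP; split; lra.
have Zx : Z x <= Z 0.
  have [x0 xX'] := andP xX.
  apply: (@le0_is_derive _ Z Z1) => // y /andP[y0 yx].
    by apply: dZ; apply/andP; split; lra.
  have yX : 0 <= y <= X by apply/andP; split; lra.
  have [vy0 vy1] := andP (v1 y y0).
  have := comparison_form (D1 y) A0 G0 vy0 (expR_ge0 (A * v y))
    (second_derivative_gap hm G0 hG hS hT yX).
  rewrite -/(E y) -/(D y) -/(D2 y).
  have : 2 * G ^+ 2 * E y <= B.
    rewrite /B mulrAC ler_wpM2r ?sqr_ge0// ler_wpM2l// ler_expR.
    by rewrite ler_piMr.
  by rewrite /Z1; lra.
have D00 : D 0 = 0 by case: hS hT => [S0 _ _] [T0 _ _]; rewrite /D S0 T0 subrr.
have D10 : D1 0 = 0 by case: hS hT => [_ S0 _] [_ T0 _]; rewrite /D1 S0 T0 subrr.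
have [x0 xX'] := andP xX.
have B0 : 0 <= B by rewrite /B mulr_ge0 ?sqr_ge0// mulr_ge0// expR_ge0.
have Qx0 : 0 <= Q x.
  have [vx0 _] := andP (v1 x x0).
  by rewrite addr_ge0// mulr_ge0// ?sqr_ge0// exprn_ge0.
have E1 : 1 <= E x.
  have [vx0 _] := andP (v1 x x0).
  by rewrite -[leLHS]expR0 ler_expR mulr_ge0.
have Qx : Q x <= B * (1 + x).
  have : Q x <= Q x * E x by rewrite ler_peMr.
  move: Zx; rewrite /Z {2}/Q D00 D10.
  by rewrite !expr0n /= !mulr0 addr0 mul0r addr0 mulr1; lra.
(* Since [2 expR A >= 1], it is at most its square; this avoids a root in [comparison_constant]. *)
have BG : B <= (comparison_constant m * G) ^+ 2.
  rewrite /B /comparison_constant -/A exprMn ler_wpM2r ?sqr_ge0//.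
  have : 1 <= expR A by rewrite -[leLHS]expR0 ler_expR.
  by move: (expR A) => e e1; nra.
have C0 : 0 <= comparison_constant m * G.
  by rewrite mulr_ge0// /comparison_constant mulr_ge0// expR_ge0.
move: Qx; rewrite /Q -[D x]/(S x - T x) -[D1 x]/(S1 x - T1 x).
move: (S x - T x) (S1 x - T1 x) => d d1.
have u0 : 0 < 1 + x by lra.
rewrite /v; move: (1 + x) u0 => u u0 Qx.
have H1 : d1 ^+ 2 / u <= B * u.
  apply: le_trans Qx; rewrite mulrC lerDl mulr_ge0 ?sqr_ge0// exprn_ge0// invr_ge0 ltW//.
have H2 : d ^+ 2 / u ^+ 3 <= B * u.
  apply: le_trans Qx; rewrite exprVn addrC mulrC lerDl mulr_ge0 ?sqr_ge0// invr_ge0 ltW//.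
split.
- rewrite -(@ler_pXn2r _ 2)// ?nnegrE//; last by apply: mulr_ge0 => //; apply: exprn_ge0; exact: ltW.
  rewrite real_normK ?num_real// exprMn.
  move: H2; rewrite ler_pdivrMr ?exprn_gt0// => /le_trans; apply.
  rewrite -mulrA -exprS -exprM ler_wpM2r ?exprn_ge0// ltW//.
- rewrite -(@ler_pXn2r _ 2)// ?nnegrE//; last by apply: mulr_ge0 => //; exact: ltW.
  rewrite real_normK ?num_real// exprMn.
  move: H1; rewrite ler_pdivrMr// => /le_trans; apply.
  rewrite -mulrA -expr2 ler_wpM2r ?exprn_ge0// ltW//.
Qed.

End comparison.

(** * Local consequences of the norm bound and of evenness, and the derivative of [Phi] *)

Section local_bounds.
Context {R : realType}.
Local Notation leb := (@lebesgue_measure R).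
Implicit Types (m sigma x y : R) (f F V r : R -> R).

Lemma Lnorm2_local f (n x y : R) : continuous f -> 0 <= n <= 1 ->
  'N[leb]_2%:E[EFin \o f]%E = n%:E ->
  \int[leb]_(t in `[x, y]) (f t ^+ 2) <= 1.
Proof.
move=> cf /andP[n0 n1] fn.
have cf2 : continuous (fun t => f t ^+ 2).
  by move=> t; apply: (@continuousM _ _ f f t); exact: cf.
have I : (\int[leb]_t (f t ^+ 2)%:E <= 1)%E.
  have := @poweR_Lnorm _ _ R leb (EFin \o f) 2 (lt0r_neq0 (ltr0n R 2)).
  rewrite fn poweR_EFin powR_mulrn// => E.
  rewrite (_ : \int[leb]_t _ = \int[leb]_t (`|(EFin \o f) t| `^ 2))%E.
    by rewrite -E lee_fin expr_le1.
  apply: eq_integral => t _.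
  by rewrite -[RHS]/((`|f t| `^ 2)%:E) powR_mulrn// real_normK ?num_real.
have J : (\int[leb]_(t in `[x, y]) (f t ^+ 2)%:E <= 1)%E.
  apply: le_trans I; apply: ge0_subset_integral => //.
    by apply/measurable_EFinP; apply: continuous_measurable_fun; exact: cf2.
  by move=> t _; rewrite lee_fin sqr_ge0.
rewrite /Rintegral -lee_fin fineK//.
apply: integrable_fin_num => //; exact: continuous_itv_integrable.
Qed.

(** The function [F z + F (- z)] has zero derivative on [[0, y]], hence is constant there. *)
Lemma even_antiderivative f F a : even_function f ->
  (forall x, - a < x -> is_derive x 1 F (f x)) ->
  forall y, 0 <= y -> y < a -> F 0 - F (- y) = F y - F 0.
Proof.
move=> ef dF y y0 ya.
have dN x : 0 <= x <= y -> is_derive x 1 (fun z => F (0 + -1 * z)) (- f x).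
  move=> /andP[x0 xy]; rewrite -(mulN1r (f x)) -(ef x).
  apply: is_derive_affine; rewrite add0r mulN1r; apply: dF; lra.
have dD x : 0 <= x <= y -> is_derive x 1 (fun z => F z + F (0 + -1 * z)) 0.
  move=> xy; have [x0 xy'] := andP xy.
  by have := is_deriveD_fun (dF x ltac:(lra)) (dN x xy); rewrite subrr.
have h1 := le0_is_derive y0 dD (fun x _ => lexx 0).
have h2 := ge0_is_derive y0 dD (fun x _ => lexx 0).
move: h1 h2; rewrite mulr0 addr0 add0r mulN1r; lra.
Qed.

Lemma derive_Phi m x : 1 < m -> x < 1 ->
  (Phi m)^`() x = (m + 1)^-1 * ((1 - x) `^ (- (m + 1)) - 1).
Proof.
move=> hm x1; apply: is_derive_derive1.
have x0 : 0 < 1 - x by lra.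
have d1 := @is_derive_powR_comp _ (fun y => 1 - y) (- m) x _ x0
  (is_deriveB_fun (is_derive_cst (1 : R) x 1) (is_derive_id x (1 : R))).
have := is_deriveZ_fun (m * (m + 1))^-1 (is_deriveB_fun (is_deriveB_fun d1
  (is_deriveZ_fun m (is_derive_id x (1 : R)))) (is_derive_cst (1 : R) x 1)).
rewrite (_ : - m - 1 = - (m + 1)); last by ring.
rewrite (_ : (m * (m + 1))^-1 * _ = (m + 1)^-1 * ((1 - x) `^ (- (m + 1)) - 1)) //.
by field; rewrite !lt0r_neq0//; lra.
Qed.

End local_bounds.

(** * Pointwise bounds for a single wave *)

Section single_wave.
Context {R : realType}.
Local Notation leb := (@lebesgue_measure R).
Implicit Types (m sigma n x y : R) (f F V r : R -> R).

(** Data of one member of a high-energy family. Estimates for such a wave with constants depending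
    on [m] alone are uniform over the family. *)
Definition subunit_wave m V r sigma : Prop :=
  [/\ solitary_wave m V r sigma, admissible_profile V, admissible_profile r,
      forall x, 0 <= r x < 1
    & exists2 n, 0 <= n <= 1 & 'N[leb]_2%:E[EFin \o V]%E = n%:E].

Lemma admissible_continuous f : admissible_profile f -> continuous f.
Proof.
case=> _ [df _ _ _] _ _ _ x.
by apply/differentiable_continuous/derivable1_diffP.
Qed.

Lemma admissible_antitone f x y : admissible_profile f -> `|x| <= `|y| -> f y <= f x.
Proof.
by move=> af; have cf := admissible_continuous af; case: af => _ _ _ ef uf; exact: unimodal_antitone.
Qed.

Variables (m sigma : R) (V r : R -> R).
Hypothesis hm : 1 < m.
Hypothesis hw : subunit_wave m V r sigma.

(* [stress x] is [Phi' (r x)]. *)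
Definition stress x : R := (m + 1)^-1 * ((1 - r x) `^ (- (m + 1)) - 1).

Let cV : continuous V. Proof. by case: hw => _ /admissible_continuous. Qed.
Let eV : even_function V. Proof. by case: hw => _ []. Qed.
Let sigma_gt0 : 0 < sigma. Proof. by case: hw => -[]. Qed.
Let r_lt1 x : r x < 1. Proof. by case: hw => _ _ _ /(_ x)/andP[]. Qed.
Let r_ge0 x : 0 <= r x. Proof. by case: hw => _ _ _ /(_ x)/andP[]. Qed.

Lemma wave_V_antitone x y : `|x| <= `|y| -> V y <= V x.
Proof. by case: hw => _ aV _ _ _; exact: admissible_antitone. Qed.

Lemma wave_r_antitone x y : `|x| <= `|y| -> r y <= r x.
Proof. by case: hw => _ _ ar _ _; exact: admissible_antitone. Qed.

Lemma stress_antitone x y : `|x| <= `|y| -> stress y <= stress x.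
Proof.
have h := hm; move=> xy; have rxy := wave_r_antitone xy.
have rx := r_lt1 x; have ry := r_lt1 y.
by rewrite /stress ler_wpM2l ?invr_ge0 ?lerD2r ?powRN_antitone//; lra.
Qed.

Lemma stress_ge0 x : 0 <= stress x.
Proof.
have h := hm; have rx := r_lt1 x; have rx0 := r_ge0 x.
rewrite /stress mulr_ge0 ?invr_ge0 ?subr_ge0//; first by lra.
by have := @powRN_antitone _ (m + 1) (1 - r x) 1; rewrite powR1; apply; lra.
Qed.

Lemma stress_le x : stress x <= (m + 1)^-1 * (1 - r x) `^ (- (m + 1)).
Proof. by have h := hm; rewrite /stress ler_wpM2l ?invr_ge0; lra. Qed.

Lemma stress_even : even_function stress.
Proof. by case: hw => _ _ [_ _ _ er _] _ _ x; rewrite /stress er. Qed.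

Lemma stress_continuous : continuous stress.
Proof.
move=> x; have rx := r_lt1 x; case: hw => _ _ [_ [dr _ _ _] _ _ _] _ _.
have dr1 : is_derive x 1 r (r^`() x) by rewrite derive1E; exact: derivableP.
have d1 := is_deriveB_fun (is_derive_cst (1 : R) x 1) dr1.
have rx0 : 0 < 1 - r x by lra.
have := is_deriveZ_fun (m + 1)^-1 (is_deriveB_fun
  (@is_derive_powR_comp _ (fun y => 1 - r y) (- (m + 1)) x _ rx0 d1)
  (is_derive_cst (1 : R) x 1)).
exact: is_derive_continuous.
Qed.

Lemma wave_avg_stress x : sigma * V x = avg stress x.
Proof.
case: hw => [[_ _ _ _ ->] _ _ _ _]; congr (avg _ x).
by apply/funext => y; rewrite derive_Phi.
Qed.

Lemma is_derive_wave_r x : is_derive x 1 r (V (x + 1/2) - V (x - 1/2)).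
Proof.
have -> : r = avg V by case: hw => [[_ _ _ h _] _ _ _ _]; apply/funext.
exact: is_derive_avg.
Qed.

Lemma is_derive_wave_V x :
  is_derive x 1 V (sigma^-1 * (stress (x + 1/2) - stress (x - 1/2))).
Proof.
have -> : V = (fun y => sigma^-1 * avg stress y).
  apply/funext => y; rewrite -wave_avg_stress mulKf//; exact: lt0r_neq0.
by apply: is_deriveZ_fun; apply: is_derive_avg; exact: stress_continuous.
Qed.

(** Turns both wave equations into difference identities for two fixed primitives. The base point -4
    is to the left of all windows used below. *)
Let wave_antiderivatives : exists F, exists FU,
  [/\ forall x, -4 < x -> is_derive x 1 F (V x),
      forall x, -4 < x -> is_derive x 1 FU (stress x),
      forall x, -3 < x -> r x = F (x + 1/2) - F (x - 1/2)
    & forall x, -3 < x -> sigma * V x = FU (x + 1/2) - FU (x - 1/2)].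
Proof.
have [F [dF aF]] := avg_antiderivative (-4) cV.
have [FU [dFU aFU]] := avg_antiderivative (-4) stress_continuous.
exists F, FU; split=> // x x3; last by rewrite wave_avg_stress aFU//; lra.
by case: hw => [[_ _ _ -> _] _ _ _ _]; rewrite aF//; lra.
Qed.

(** The window [[0, 1]] of the point 1/2 contains the right half of the window of 0, so
    [V 0 <= 2 * V (1/2)] because the stress is even and nonnegative. Monotonicity of [V] on
    [[0, 1/2]] gives [V (1/2) <= r 0]. *)
Lemma wave_V0_le : V 0 <= 2 * r 0.
Proof.
have [F [FU [dF dFU rF VFU]]] := wave_antiderivatives.
have symF := even_antiderivative eV dF; have symU := even_antiderivative stress_even dFU.
have H1 : 1/2 * V (1/2) <= F (1/2) - F 0.
  have := @le_is_derive _ (fun z => V (1/2) * z) (cst (V (1/2))) F V 0 (1/2).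
  move=> /(_ ltac:(lra)) H.
  have : V (1/2) * (1/2) - V (1/2) * 0 <= F (1/2) - F 0.
    apply: H => z /andP[z0 z1].
    - by have := is_deriveZ_fun (V (1/2)) (is_derive_id z (1:R)); rewrite mulr1.
    - by apply: dF; lra.
    - by apply: wave_V_antitone; rewrite !ger0_norm; lra.
  by lra.
have R0 : r 0 = 2 * (F (1/2) - F 0).
  rewrite rF; last by lra.
  have := symF (1/2); rewrite add0r sub0r => /(_ ltac:(lra) ltac:(lra)); lra.
have V0 : sigma * V 0 = 2 * (FU (1/2) - FU 0).
  rewrite VFU; last by lra.
  have := symU (1/2); rewrite add0r sub0r => /(_ ltac:(lra) ltac:(lra)); lra.
have V1 : FU (1/2) - FU 0 <= sigma * V (1/2).
  rewrite VFU; last by lra.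
  rewrite (_ : 1/2 + 1/2 = 1); last by field.
  rewrite subrr lerD2r; apply: (@ge0_is_derive _ _ stress); first by lra.
  - by move=> z /andP[z0 _]; apply: dFU; lra.
  - by move=> z _; exact: stress_ge0.
have : V 0 <= 2 * V (1/2).
  by have s0 := sigma_gt0; rewrite -(@ler_pM2l _ sigma)//; lra.
by move: H1 R0; lra.
Qed.

(** Here and in the next two lemmas, an average over a unit window is at most the maximum of the
    function on that window. *)
Lemma wave_V0_ge : r 0 <= V 0.
Proof.
have [F [FU [dF dFU rF VFU]]] := wave_antiderivatives.
rewrite rF; last by lra.
have := @le_is_derive _ F V (fun z => V 0 * z) (cst (V 0)) (0 - 1/2) (0 + 1/2).
move=> /(_ ltac:(lra)) H.
rewrite (_ : V 0 = V 0 * (0 + 1/2) - V 0 * (0 - 1/2)); last by field.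
apply: H => z /andP[z0 z1].
- by apply: dF; lra.
- by have := is_deriveZ_fun (V 0) (is_derive_id z (1:R)); rewrite mulr1.
- by apply: wave_V_antitone; rewrite normr0.
Qed.

Lemma wave_sigmaV0_le : sigma * V 0 <= stress 0.
Proof.
have [F [FU [dF dFU rF VFU]]] := wave_antiderivatives.
rewrite VFU; last by lra.
have := @le_is_derive _ FU stress (fun z => stress 0 * z) (cst (stress 0)) (0 - 1/2) (0 + 1/2).
move=> /(_ ltac:(lra)) H.
rewrite (_ : stress 0 = stress 0 * (0 + 1/2) - stress 0 * (0 - 1/2)); last by field.
apply: H => z /andP[z0 z1].
- by apply: dFU; lra.
- by have := is_deriveZ_fun (stress 0) (is_derive_id z (1:R)); rewrite mulr1.
- by apply: stress_antitone; rewrite normr0.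
Qed.

Lemma wave_sigmaV1_le : sigma * V 1 <= stress (1/2).
Proof.
have [F [FU [dF dFU rF VFU]]] := wave_antiderivatives.
rewrite VFU; last by lra.
have := @le_is_derive _ FU stress (fun z => stress (1/2) * z) (cst (stress (1/2))) (1 - 1/2) (1 + 1/2).
move=> /(_ ltac:(lra)) H.
rewrite (_ : stress (1/2) = stress (1/2) * (1 + 1/2) - stress (1/2) * (1 - 1/2)); last by field.
apply: H => z /andP[z0 z1].
- by apply: dFU; lra.
- by have := is_deriveZ_fun (stress (1/2)) (is_derive_id z (1:R)); rewrite mulr1.
- by apply: stress_antitone; rewrite !ger0_norm; lra.
Qed.

(* The unit norm leaves little mass outside [-1/2, 1/2], where [V] already
   integrates to [r 0]; quantified by [V^2 >= 2 V - 1] on [[0, 1/2]] and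
   [V^2 >= V - 1/4] on [[1/2, 1]]. *)
Lemma wave_tail : r (1/2) <= 9/8 - r 0 / 2 /\ V 1 <= 9/4 - 2 * r 0.
Proof.
have [F [FU [dF dFU rF VFU]]] := wave_antiderivatives.
have cV2 : continuous (fun z => V z ^+ 2).
  by move=> t; apply: (@continuousM _ _ V V t); exact: cV.
have [P [dP iP]] := continuous_antiderivative (-4) cV2.
have eV2 : even_function (fun z => V z ^+ 2) by move=> z; rewrite eV.
have symF := even_antiderivative eV dF; have symP := even_antiderivative eV2 dP.
have R0 : r 0 = 2 * (F (1/2) - F 0).
  rewrite rF; last by lra.
  have := symF (1/2); rewrite add0r sub0r => /(_ ltac:(lra) ltac:(lra)); lra.
have R1 : r (1/2) = F 1 - F 0.
  by rewrite rF; [rewrite subrr (_ : 1/2 + 1/2 = 1)//; field|lra].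
have P1 : 2 * (P 1 - P 0) <= 1.
  have [_ _ _ _ [n n1 /(Lnorm2_local (-1) 1 cV n1)]] := hw.
  rewrite iP; [|lra..].
  have := symP 1 => /(_ ltac:(lra) ltac:(lra)); lra.
have A : 2 * (F (1/2) - F 0) - 1/2 <= P (1/2) - P 0.
  have := @le_is_derive _ (fun z => 2 * F z - z) (fun z => 2 * V z - 1)
    P (fun z => V z ^+ 2) 0 (1/2).
  move=> /(_ ltac:(lra)) H.
  have : 2 * F (1/2) - 1/2 - (2 * F 0 - 0) <= P (1/2) - P 0.
    apply: H => z /andP[z0 z1].
    - by apply: is_deriveB_fun; apply: is_deriveZ_fun; apply: dF; lra.
    - by apply: dP; lra.
    - by have := sqr_ge0 (V z - 1); nra.
  by lra.
have B : F 1 - F (1/2) - 1/8 <= P 1 - P (1/2).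
  have := @le_is_derive _ (fun z => F z - 1/4 * z) (fun z => V z - 1/4 * 1)
    P (fun z => V z ^+ 2) (1/2) 1.
  move=> /(_ ltac:(lra)) H.
  have : F 1 - 1/4 * 1 - (F (1/2) - 1/4 * (1/2)) <= P 1 - P (1/2).
    apply: H => z /andP[z0 z1].
    - by apply: is_deriveB_fun; apply: dF; lra.
    - by apply: dP; lra.
    - by have := sqr_ge0 (V z - 1/2); nra.
  by lra.
have C : 1/2 * V 1 <= F 1 - F (1/2).
  have := @le_is_derive _ (fun z => V 1 * z) (cst (V 1)) F V (1/2) 1.
  move=> /(_ ltac:(lra)) H.
  have : V 1 * 1 - V 1 * (1/2) <= F 1 - F (1/2).
    apply: H => z /andP[z0 z1].
    - by have := is_deriveZ_fun (V 1) (is_derive_id z (1:R)); rewrite mulr1.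
    - by apply: dF; lra.
    - by apply: wave_V_antitone; rewrite !ger0_norm; lra.
  by lra.
(* Adding [A] and [B] and using [P1] bounds the integral of [V] over [[1/2, 1]] by [9/8 - r 0]; both
   claims follow from this. *)
by split; lra.
Qed.

End single_wave.

(** * The rescaled wave as an almost solution of the limit equation *)

Section rescaled_wave.
Context {R : realType}.
Implicit Types (m sigma x y : R) (V r T : R -> R).

(** For a single wave, [tip], [width] and [rescaled_V] are [eps_par], [mu_par] and [Wdelta]. *)
Definition tip r : R := 1 - r 0.

Definition width m sigma r : R := Num.sqrt (sigma * tip r `^ (m + 2)).

Definition rescaled_V m sigma V r x : R :=
  width m sigma r / tip r * V (- (1/2) + width m sigma r * x).

Definition rescaled_V1 m sigma r x : R :=
  tip r `^ (m + 1) * (stress m r (width m sigma r * x) - stress m r (width m sigma r * x - 1)).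

(* The rescaled gap function, with [1 - r (mu x) = eps (1 + S x)]. *)
Definition gap m sigma r x : R := (tip r)^-1 * (1 - r (width m sigma r * x)) - 1.

(** The advanced value [V (mu x + 1/2)] equals [V (- 1/2 - mu x)] by evenness, so the derivative of
    the gap is the odd part of the rescaled velocity, doubled. *)
Definition gap1 m sigma V r x : R := rescaled_V m sigma V r x - rescaled_V m sigma V r (- x).

Definition gap2 m sigma r x : R := rescaled_V1 m sigma r x + rescaled_V1 m sigma r (- x).

(** What separates the derivative of the rescaled velocity from half the force: the constant
    subtracted in the stress, and the stress at the shifted point. *)
Definition defect m sigma r x : R :=
  tip r `^ (m + 1) * ((m + 1)^-1 + stress m r (width m sigma r * x - 1)).

(** The number 1/4 is a lower bound for [1 - r (1/2)] when the tip is small. *)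
Definition defect_bound m : R := (m + 1)^-1 * (1 + (1/4) `^ (- (m + 1))).

Variables (m sigma : R) (V r : R -> R).
Hypothesis hm : 1 < m.
Hypothesis hw : subunit_wave m V r sigma.

Local Notation eps := (tip r).
Local Notation mu := (width m sigma r).
Local Notation W := (rescaled_V m sigma V r).
Local Notation W1 := (rescaled_V1 m sigma r).
Local Notation S := (gap m sigma r).
Local Notation S1 := (gap1 m sigma V r).
Local Notation S2 := (gap2 m sigma r).
Local Notation h := (defect m sigma r).
Local Notation X := (1 / (2 * mu)).
Local Notation K := (defect_bound m).

Let r_bounds x : 0 <= r x < 1. Proof. by case: hw => _ _ _ /(_ x). Qed.

Let sigma_gt0 : 0 < sigma. Proof. by case: hw => -[]. Qed.

Lemma tip_gt0 : 0 < eps.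
Proof. by have /andP[] := r_bounds 0; rewrite /tip; lra. Qed.

Lemma tip_le1 : eps <= 1.
Proof. by have /andP[] := r_bounds 0; rewrite /tip; lra. Qed.

Lemma width_gt0 : 0 < mu.
Proof. by rewrite /width sqrtr_gt0 mulr_gt0// powR_gt0// tip_gt0. Qed.

Lemma width_sqr : mu ^+ 2 = sigma * eps `^ (m + 2).
Proof. by rewrite /width sqr_sqrtr// mulr_ge0 ?powR_ge0// ltW. Qed.

(** The scaling of [mu] is made for this identity: the factor [sigma] cancels the one in the
    equation for [V], leaving [eps^(m + 1)]. *)
Lemma width_sqr_tip : mu * (mu / eps) = sigma * eps `^ (m + 1).
Proof.
have e0 := tip_gt0; rewrite mulrA -expr2 width_sqr.
rewrite (_ : m + 2 = m + 1 + 1); last by ring.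
rewrite (@powRD _ eps (m + 1) 1); last by rewrite lt0r_neq0// implybT.
by rewrite powRr1 ?(ltW e0)// !mulrA mulfK// lt0r_neq0.
Qed.

Lemma tip_powD p : eps `^ (p + 1) = eps * eps `^ p.
Proof.
have e0 := tip_gt0.
rewrite (@powRD _ eps p 1); last by rewrite lt0r_neq0// implybT.
by rewrite powRr1 ?(ltW e0)// mulrC.
Qed.

Lemma is_derive_rescaled_V x : is_derive x 1 W (W1 x).
Proof.
have d1 := is_derive_affine (is_derive_wave_V hm hw (- (1/2) + mu * x)).
have := is_deriveZ_fun (mu / eps) d1.
rewrite (_ : - (1/2) + mu * x + 1/2 = mu * x); last by ring.
rewrite (_ : - (1/2) + mu * x - 1/2 = mu * x - 1); last by field.
rewrite (_ : _ * (mu * _) = W1 x)// /rescaled_V1.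
move: (stress _ _ _ - _) => D; transitivity (mu * (mu / eps) / sigma * D); first by ring.
by rewrite width_sqr_tip (mulrC sigma) mulfK// lt0r_neq0.
Qed.

Let V_even : even_function V. Proof. by case: hw => _ []. Qed.
Let r_even : even_function r. Proof. by case: hw => _ _ []. Qed.

Lemma is_derive_gap x : is_derive x 1 S (S1 x).
Proof.
have d1 := is_derive_affine (is_derive_wave_r hw (0 + mu * x)).
have := is_deriveB_fun (is_deriveZ_fun (eps)^-1 (is_deriveB_fun (is_derive_cst (1 : R) x 1) d1))
  (is_derive_cst (1 : R) x 1).
rewrite (_ : (fun _ => _) = S); last first.
  by apply/funext => y; rewrite /gap add0r.
rewrite (_ : _ - 0 = S1 x) // /gap1 /rescaled_V mulrN (add0r (mu * x)) -(V_even (mu * x + _)).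
rewrite (_ : - (mu * x + 1/2) = - (1/2) - mu * x); last by ring.
by rewrite (addrC (mu * x)); ring.
Qed.

Lemma is_derive_gap1 x : is_derive x 1 S1 (S2 x).
Proof.
have d1 := is_derive_affine (F := W) (a := 0) (b := -1) (x := x) (is_derive_rescaled_V _).
have := is_deriveB_fun (is_derive_rescaled_V x) d1.
rewrite add0r !mulN1r opprK (_ : (fun _ => _) = S1)//.
by apply/funext => y; rewrite add0r mulN1r.
Qed.

Lemma gap_even : even_function S.
Proof. by move=> x; rewrite /gap mulrN r_even. Qed.

Lemma rescaled_V1E x : W1 x = force m (S x) / 2 - h x.
Proof.
have hm' := hm; have e0 := tip_gt0; have /andP[_ rx] := r_bounds (mu * x).
rewrite /rescaled_V1 /force /defect /gap subrKC.
rewrite powRM ?invr_ge0; [|lra..].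
rewrite -(powR_inv1 (ltW e0)) -powRrM (_ : -1 * - (m + 1) = m + 1); last by ring.
rewrite {1}/stress; field; rewrite !lt0r_neq0//; lra.
Qed.

Lemma gap2E x : S2 x = force m (S x) - (h x + h (- x)).
Proof. by rewrite /gap2 !rescaled_V1E gap_even; field. Qed.

Lemma halfwidthP x : - X <= x <= X -> -(1/2) <= mu * x <= 1/2.
Proof.
have u0 := width_gt0.
rewrite (_ : X = (1/2) / mu); last by field; rewrite lt0r_neq0.
by rewrite -mulNr ler_pdivrMr// ler_pdivlMr// (mulrC x).
Qed.

(** On this interval [mu * x] is closer to the peak at 0 than the shifted point [mu * x - 1]. *)
Lemma rescaled_V1_ge0 x : - X <= x <= X -> 0 <= W1 x.
Proof.
move/halfwidthP => /andP[x1 x2].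
rewrite /rescaled_V1 mulr_ge0 ?powR_ge0// subr_ge0; apply: (stress_antitone hm hw).
rewrite (@ler0_norm _ (_ - 1)); last by lra.
by rewrite ler_norml; apply/andP; split; lra.
Qed.

Section small_tip.
Hypothesis eps_small : eps <= 1/6.

(** From [r 0 >= 5/6] the tail bound gives [r (1/2) <= 17/24 < 3/4]. *)
Lemma stress_half_le : stress m r (1/2) <= (m + 1)^-1 * (1/4) `^ (- (m + 1)).
Proof.
have hm' := hm; have es := eps_small.
apply: (le_trans (stress_le r hm (1/2))).
have [r2 _] := wave_tail hm hw.
rewrite ler_wpM2l ?invr_ge0 ?powRN_antitone//; try lra.
by move: es r2; rewrite /tip; lra.
Qed.

(** The shifted point stays at distance at least 1/2 from 0, where the stress is at most
    [stress (1/2)]. *)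
Lemma defect_le x : - X <= x <= X -> 0 <= h x <= K * eps `^ (m + 1).
Proof.
have hm' := hm; move/halfwidthP => /andP[x1 x2].
have s1 : stress m r (mu * x - 1) <= stress m r (1/2).
  apply: (stress_antitone hm hw).
  by rewrite (@ler0_norm _ (_ - 1)) ?ger0_norm; lra.
have s0 := stress_ge0 hm hw (mu * x - 1).
have i0 : 0 <= (m + 1)^-1 by rewrite invr_ge0; lra.
apply/andP; split; first by rewrite /defect mulr_ge0 ?powR_ge0// addr_ge0.
rewrite /defect mulrC ler_wpM2r ?powR_ge0// /defect_bound mulrDr mulr1 lerD2l.
by apply: (le_trans s1); exact: stress_half_le.
Qed.

Lemma gap_almost_solution : almost_solution m X (2 * K * eps `^ (m + 1)) S S1 S2.
Proof.
have e0 := tip_gt0; split.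
- by rewrite /gap mulr0 mulVf ?subrr// lt0r_neq0.
- by rewrite /gap1 oppr0 subrr.
move=> x /andP[x0 xX].
have xX1 : - X <= x <= X by apply/andP; split; lra.
have xX2 : - X <= - x <= X by apply/andP; split; lra.
have /andP[h0 h1] := defect_le xX1; have /andP[h2 h3] := defect_le xX2.
split; [exact: is_derive_gap|exact: is_derive_gap1| |].
- by rewrite /gap2 addr_ge0 ?rescaled_V1_ge0.
- by rewrite gap2E; apply/andP; split; lra.
Qed.

End small_tip.
End rescaled_wave.

(** * Bounds for the limit profile [S0] *)

Section limit_profile.
Context {R : realType}.
Implicit Types (m X x : R) (T : R -> R).

Lemma is_S0_is_derive m T x : is_S0 m T -> is_derive x 1 T (derive1 T x).
Proof. by case=> dT _ _ _ _; have [/derivableP] := dT x; rewrite -derive1E. Qed.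

Lemma is_S0_is_derive2 m T x : is_S0 m T -> is_derive x 1 (derive1 T) (force m (T x)).
Proof.
case=> dT _ T2 _ _; rewrite /force -T2.
by have [_ /derivableP] := dT x; rewrite -derive1E.
Qed.

Lemma is_S0_almost_solution m X T : 1 < m -> is_S0 m T ->
  almost_solution m X 0 T (derive1 T) (fun x => force m (T x)).
Proof.
move=> hm hT; split; [by case: hT|by case: hT|move=> x _].
split; [exact: is_S0_is_derive hT|exact: is_S0_is_derive2 hT|exact: force_ge0|].
by rewrite subr0 lexx.
Qed.

Lemma is_S0_reflect_derive m T x : is_S0 m T -> is_derive x 1 (fun y => T (- y)) (- derive1 T (- x)).
Proof.
move=> hT; have := is_derive_affine (F := T) (a := 0) (b := -1) (x := x) (is_S0_is_derive _ hT).
rewrite add0r !mulN1r (_ : (fun _ => _) = (fun y => T (- y)))//.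
by apply/funext => y; rewrite add0r mulN1r.
Qed.

Lemma is_S0_reflect_derive1 m T x : is_S0 m T -> derive1 (fun y => T (- y)) x = - derive1 T (- x).
Proof. by move=> hT; apply: is_derive_derive1; exact: is_S0_reflect_derive hT. Qed.

(* Replaces evenness of [T], which would need uniqueness for the equation. *)
Lemma is_S0_reflect m T : is_S0 m T -> is_S0 m (fun x => T (- x)).
Proof.
move=> hT.
have E : derive1 (fun y => T (- y)) = (fun y => - derive1 T (- y)).
  by apply/funext => y; rewrite (is_S0_reflect_derive1 _ hT).
have d2 x : is_derive x 1 (fun y => - derive1 T (- y)) (force m (T (- x))).
  have := is_derive_affine (F := derive1 T) (a := 0) (b := -1) (x := x) (is_S0_is_derive2 _ hT).
  move/is_deriveN; rewrite add0r !mulN1r opprK.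
  rewrite (_ : - (fun _ => _) = (fun y => - derive1 T (- y)))//.
  by apply/funext => y; rewrite fctE add0r mulN1r.
split.
- move=> x; rewrite E; split.
    exact: (@ex_derive _ _ _ _ _ _ _ (is_S0_reflect_derive x hT)).
  exact: (@ex_derive _ _ _ _ _ _ _ (d2 x)).
- by move=> x; case: hT.
- move=> x; rewrite -[LHS]/(derive1 (derive1 (fun y => T (- y))) x) E.
  exact: is_derive_derive1.
- by rewrite oppr0; case: hT.
- by rewrite E oppr0; case: hT => _ _ _ _ ->; rewrite oppr0.
Qed.

Lemma is_S0_bounds m T x : 1 < m -> is_S0 m T -> 0 <= T x /\ `|derive1 T x| <= mubar m.
Proof.
move=> hm; wlog x0 : x T / 0 <= x.
  move=> H hT; have [x0|x0] := leP 0 x; first exact: H.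
  have [|Tx] := H (- x) _ _ (is_S0_reflect hT); first by lra.
  by rewrite (is_S0_reflect_derive1 _ hT) opprK normrN in Tx *.
move=> hT; have hA := is_S0_almost_solution x hm hT.
have xx : 0 <= x <= x by rewrite x0 lexx.
have [T0 T1] := almost_solution_ge0 hA xx; split=> //.
by rewrite ger0_norm//; exact: (almost_solution_slope_le hm hA xx).
Qed.

(** Energy is conserved, so the squared slope is [mubar^2 (1 - z)] with [z = (1 + T x)^(-m)] in
    [[0, 1]], and [(1 - z)^2 <= 1 - z]. Linear growth bounds [z]. *)
Lemma is_S0_slope_ge m T x : 1 < m -> is_S0 m T -> 0 < x ->
  mubar m * (1 - (force m (1/2) / 2 * x) `^ (- m)) <= derive1 T x.
Proof.
move=> hm hT x0; have hA := is_S0_almost_solution x hm hT.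
have xx : 0 <= x <= x by rewrite ltW ?lexx.
have [T0 T1] := almost_solution_ge0 hA xx.
have c0 : 0 < force m (1/2) / 2 by rewrite divr_gt0// force_gt0//; lra.
have cx : 0 < force m (1/2) / 2 * x by rewrite mulr_gt0.
have growth := almost_solution_growth hm hA (ltW c0) xx.
have b0 := mubar_gt0 hm.
have z1 : (1 + T x) `^ (- m) <= 1.
  by have := @powRN_antitone _ m 1 (1 + T x); rewrite powR1; apply; lra.
have z0 := powR_ge0 (1 + T x) (- m).
apply: (@le_trans _ _ (mubar m * (1 - (1 + T x) `^ (- m)))).
  rewrite ler_wpM2l ?(ltW b0)// lerD2l lerN2 powRN_antitone//; lra.
have en := almost_solution_energy_ge hm hA (lexx 0) xx.
rewrite potentialE// in en.
rewrite -(@ler_pXn2r _ 2)// ?nnegrE//; last by rewrite mulr_ge0 ?subr_ge0 ?(ltW b0).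
apply: le_trans en; rewrite exprMn ler_wpM2l ?sqr_ge0//.
by move: (_ `^ _) z0 z1 => z z0 z1; nra.
Qed.

End limit_profile.

(** * Convergence of the rescaled wave when the tip is small *)

Section convergence.
Context {R : realType}.
Variables (m sigma : R) (V r : R -> R).
Hypothesis hm : 1 < m.
Hypothesis hw : subunit_wave m V r sigma.

Local Notation eps := (tip r).
Local Notation mu := (width m sigma r).
Local Notation W := (rescaled_V m sigma V r).
Local Notation W1 := (rescaled_V1 m sigma r).
Local Notation S := (gap m sigma r).
Local Notation S1 := (gap1 m sigma V r).
Local Notation X := (1 / (2 * mu)).
Local Notation K := (defect_bound m).
Local Notation c := (force m (1/2) / 2).
Local Notation B := (comparison_constant m).

Let c_gt0 : 0 < c.
Proof. by rewrite divr_gt0// force_gt0//; lra. Qed.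

Let K_gt0 : 0 < K.
Proof.
have hm' := hm; rewrite /defect_bound mulr_gt0 ?invr_gt0; try lra.
by have := powR_ge0 (1/4 : R) (- (m + 1)); lra.
Qed.

Let B_ge0 : 0 <= B.
Proof. by rewrite /comparison_constant mulr_ge0// expR_ge0. Qed.

Let V_ge0 x : 0 <= V x. Proof. by case: hw => _ []. Qed.
Let V_even : even_function V. Proof. by case: hw => _ []. Qed.

(** The three conditions respectively keep [r (1/2)] away from 1, make the deficit at most [c], and
    ensure [X >= 1]. *)
Hypothesis eps_small : eps <= 1/6.
Hypothesis eps_small2 : 2 * K * eps <= c.
Hypothesis eps_small3 : 8 * mubar m * eps <= 1.

Let G_le : 2 * K * eps `^ (m + 1) <= c.
Proof.
have hm' := hm; have e0 := tip_gt0 hw; have e1 := tip_le1 hw; have k0 := K_gt0.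
apply: le_trans eps_small2; rewrite ler_wpM2l//; first by lra.
by apply: ge1r_powR; [rewrite e0 e1|lra].
Qed.

Let G_ge0 : 0 <= 2 * K * eps `^ (m + 1).
Proof. by have k0 := K_gt0; rewrite mulr_ge0 ?powR_ge0//; lra. Qed.

Let X_gt0 : 0 < X.
Proof. by have u0 := width_gt0 hw; rewrite divr_gt0// mulr_gt0. Qed.

Let hA := gap_almost_solution hm hw eps_small.

Let gap1X : S1 X = mu / eps * (V 0 - V 1).
Proof.
have u0 := width_gt0 hw.
rewrite /gap1 /rescaled_V (_ : - (1/2) + mu * X = 0); last first.
  by field; rewrite lt0r_neq0.
rewrite (_ : - (1/2) + mu * - X = -1); last by field; rewrite lt0r_neq0.
by rewrite (V_even 1) mulrBr.
Qed.

(** The slope at [X] is at most [mubar], and it is [mu / eps] times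
    [V 0 - V 1 >= 3 * r 0 - 9/4 >= 1/4]. *)
Lemma width_upper : mu <= 4 * mubar m * eps.
Proof.
have u0 := width_gt0 hw; have e0 := tip_gt0 hw; have x0 := X_gt0.
have XX : 0 <= X <= X by rewrite ltW ?lexx.
have := almost_solution_slope_le hm hA XX.
rewrite gap1X mulrAC ler_pdivrMr// => H.
have : 1/4 <= V 0 - V 1.
  have := wave_V0_ge hm hw; have [_] := wave_tail hm hw; have := eps_small.
  by rewrite /tip; lra.
by nra.
Qed.

(** Since [X >= 1] the slope at [X] is at least [c], while [V 0 - V 1 <= 2]. *)
Lemma width_lower : c / 2 * eps <= mu.
Proof.
have u0 := width_gt0 hw; have e0 := tip_gt0 hw; have x0 := X_gt0.
have XX : 0 <= X <= X by rewrite ltW ?lexx.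
have X1 : 1 <= X.
  rewrite ler_pdivlMr ?mulr_gt0// mul1r.
  by have := width_upper; have := eps_small3; lra.
have := almost_solution_slope_ge hm hA G_le XX.
rewrite min_r// mulr1 gap1X (mulrAC mu) ler_pdivlMr// => H.
have v0 := wave_V0_le hm hw; have v1 := V_ge0 1.
have : V 0 - V 1 <= 2 by move: v0 e0; rewrite /tip; lra.
by nra.
Qed.

Lemma tip_mul_le x : 0 <= x <= X -> eps * x <= c^-1.
Proof.
move=> /andP[x0 xX]; have u0 := width_gt0 hw; have c0 := c_gt0.
rewrite -[leRHS]mul1r ler_pdivlMr//.
move: xX; rewrite ler_pdivlMr ?mulr_gt0// => xX.
by have := width_lower; nra.
Qed.

Lemma tip_weight_le x : 0 <= x <= X -> eps * (1 + x) <= 1 + c^-1.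
Proof. by move=> /tip_mul_le; have := tip_le1 hw; lra. Qed.

(** The comparison error carries the weight [1 + x = O(1 / eps)], which costs one power of [eps]. *)
Lemma gap1_close T x : is_S0 m T -> 0 <= x <= X ->
  `|S1 x - derive1 T x| <= 2 * B * K * (1 + c^-1) * eps `^ m.
Proof.
move=> hT xX.
have hT' := almost_solutionW (lexx X) G_ge0 (is_S0_almost_solution X hm hT).
have [_] := almost_solution_compare hm G_ge0 G_le hA hT' xX.
move/le_trans; apply; rewrite (tip_powD hw).
have -> : B * (2 * K * (eps * eps `^ m)) * (1 + x) =
  2 * B * K * (eps * (1 + x)) * eps `^ m by ring.
rewrite ler_wpM2r ?powR_ge0// ler_wpM2l ?tip_weight_le//.
by rewrite (mulr_ge0 _ (ltW K_gt0))// mulr_ge0// B_ge0.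
Qed.

(** No power of [eps] is lost here: the quadratic growth of the comparison error is compensated by
    the decay of the derivative of the force. Allowing [y = - x] covers the left half of the
    interval. *)
Lemma rescaled_V1_close T x y : is_S0 m T -> 0 <= x <= X -> y = x \/ y = - x ->
  `|W1 y - force m (T x) / 2| <= K * (comparison_rate m * B + 1) * eps `^ (m + 1).
Proof.
move=> hT xX yx; have [x0 xX'] := andP xX.
have yX : - X <= y <= X by case: yx => ->; apply/andP; split; lra.
have Sy : S y = S x by case: yx => -> //; exact: (gap_even hw).
have hT' := almost_solutionW (lexx X) G_ge0 (is_S0_almost_solution X hm hT).
have [D _] := almost_solution_compare hm G_ge0 G_le hA hT' xX.
have gap := force_gap hm G_le hA hT' xX.
have {D gap} gap : `|force m (S x) - force m (T x)| <=
    comparison_rate m * B * (2 * K * eps `^ (m + 1)).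
  apply: (le_trans gap).
  apply: (@le_trans _ _ (comparison_rate m * (1 + x)^-1 ^+ 2 *
     (B * (2 * K * eps `^ (m + 1)) * (1 + x) ^+ 2))).
    apply: ler_pM => //; first by rewrite mulr_ge0 ?comparison_rate_ge0 ?powR_ge0.
    rewrite ler_wpM2l ?comparison_rate_ge0//.
    apply: (le_trans (powRN_le_cube hm x0)).
    rewrite exprS ler_piMl ?sqr_ge0//.
    by rewrite invf_le1; lra.
  rewrite exprVn le_eqVlt; apply/orP; left; apply/eqP; field.
  by rewrite lt0r_neq0//; lra.
have /andP[h0 h1] := defect_le hm hw eps_small yX.
rewrite (rescaled_V1E hm hw) Sy.
move: gap; rewrite !ler_norml => /andP[g1 g2].
by apply/andP; split; lra.
Qed.

Let mean (x : R) : R := W x + W (- x).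

Let is_derive_mean (x : R) : is_derive x 1 mean (W1 x - W1 (- x)).
Proof.
have d1 := is_derive_affine (F := W) (a := 0) (b := -1) (x := x) (is_derive_rescaled_V hm hw _).
have := is_deriveD_fun (is_derive_rescaled_V hm hw x) d1.
rewrite add0r !mulN1r (_ : (fun _ => _) = mean)//.
by apply/funext => y; rewrite add0r mulN1r.
Qed.

(** The forces at [x] and [- x] cancel as the gap is even. Only a difference of defects remains, of
    order [eps^(m + 1)], over a length of order [1 / eps]. *)
Let mean_variation (x : R) : 0 <= x <= X -> `|mean X - mean x| <= K / c * eps `^ m.
Proof.
move=> /andP[x0 xX]; have u0 := width_gt0 hw; have c0 := c_gt0; have k0 := K_gt0.
have e0 := tip_gt0 hw.
have [y /andP[xy yX] ->] := MVT_is_derive xX (fun y _ => is_derive_mean y).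
have yX1 : - X <= y <= X by apply/andP; split; lra.
have yX2 : - X <= - y <= X by apply/andP; split; lra.
have /andP[h0 h1] := defect_le hm hw eps_small yX1.
have /andP[h2 h3] := defect_le hm hw eps_small yX2.
rewrite !(rescaled_V1E hm hw) (gap_even hw) normrM (@ger0_norm _ (X - x)); last by lra.
apply: (@le_trans _ _ (K * eps `^ (m + 1) * X)).
  apply: ler_pM => //; [lra| |lra].
  by rewrite ler_norml; apply/andP; split; lra.
rewrite (tip_powD hw) (_ : _ * X = (K * eps `^ m) * (eps * X)); last by ring.
rewrite (_ : K / c * _ = K * eps `^ m * c^-1); last by ring.
apply: ler_wpM2l; first by rewrite mulr_ge0 ?powR_ge0 ?(ltW k0).
by apply: tip_mul_le; rewrite ltW ?lexx.
Qed.

(** At [- X] the unscaled argument is -1, where [sigma * V 1 <= stress (1/2)] is bounded; dividing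
    by [mu] loses one power of [eps]. *)
Let W_end : W (- X) <= 2 * K / c * eps `^ m.
Proof.
have hm' := hm; have u0 := width_gt0 hw; have c0 := c_gt0; have k0 := K_gt0.
have e0 := tip_gt0 hw.
have H : mu * W (- X) <= eps `^ (m + 1) * K.
  rewrite /rescaled_V (_ : - (1/2) + mu * - X = -1); last by field; rewrite lt0r_neq0.
  rewrite V_even mulrA (width_sqr_tip hw) (mulrC sigma) -mulrA ler_wpM2l ?powR_ge0//.
  apply: (le_trans (wave_sigmaV1_le hm hw)); apply: (le_trans (stress_half_le hm hw eps_small)).
  by rewrite /defect_bound ler_wpM2l ?invr_ge0; lra.
rewrite -(ler_pM2l u0); apply: (le_trans H).
rewrite (tip_powD hw) (_ : mu * _ = (mu * 2 / c) * (eps `^ m * K)); last by ring.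
rewrite -(mulrA eps); apply: ler_wpM2r; first by rewrite mulr_ge0 ?powR_ge0 ?(ltW k0).
by rewrite ler_pdivlMr//; have := width_lower; lra.
Qed.

(** The slope differs from [mubar] by at most [mubar (c X)^(-m)], and [X >= 1 / (8 mubar eps)] by
    [width_upper]. *)
Let end_slope T : is_S0 m T ->
  mubar m - mubar m * (8 * mubar m / c) `^ m * eps `^ m <= derive1 T X.
Proof.
move=> hT; have u0 := width_gt0 hw; have c0 := c_gt0; have e0 := tip_gt0 hw.
have b0 := mubar_gt0 hm.
apply: le_trans (is_S0_slope_ge hm hT X_gt0).
rewrite mulrBr mulr1 lerD2l lerN2 -(mulrA (mubar m)); apply: ler_wpM2l; first exact: ltW.
have q0 : 0 < 8 * mubar m / c by rewrite divr_gt0// mulr_gt0.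
rewrite -powRM ?(ltW q0) ?(ltW e0)//.
have z0 : 0 < 8 * mubar m / c * eps by rewrite mulr_gt0.
have -> : (8 * mubar m / c * eps) `^ m = (8 * mubar m / c * eps)^-1 `^ (- m).
  by rewrite -(powR_inv1 (ltW z0)) -powRrM mulN1r opprK.
have hm' := hm; apply: powRN_antitone; [lra|by rewrite invr_gt0|].
rewrite -div1r ler_pdivrMr//.
have -> : c * X * (8 * mubar m / c * eps) = 4 * mubar m * eps / mu.
  by move: c c0 => c' c0; field; rewrite !lt0r_neq0.
by rewrite ler_pdivlMr// mul1r; exact: width_upper.
Qed.

(** Sums the slope comparison at [X], the distance of the limit slope from [mubar], and [5 K / c]:
    four from [2 * W (- X)] and one from the variation of [mean]. *)
Definition mean_constant : R :=
  2 * B * K * (1 + c^-1) + mubar m * (8 * mubar m / c) `^ m + 5 * K / c.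

Let mean_close T x : is_S0 m T -> 0 <= x <= X ->
  `|mean x - mubar m| <= mean_constant * eps `^ m.
Proof.
move=> hT xX; have x0 := X_gt0.
have XX : 0 <= X <= X by rewrite ltW ?lexx.
have slope := almost_solution_slope_le hm hA XX.
have close := gap1_close hT XX.
have ends := end_slope hT.
have var := mean_variation xX.
have We := W_end.
have We0 : 0 <= W (- X).
  by rewrite mulr_ge0// divr_ge0 ?ltW ?(width_gt0 hw) ?(tip_gt0 hw).
have mX : mean X = S1 X + 2 * W (- X) by rewrite /mean /gap1; ring.
have p1 : 0 <= 2 * B * K * (1 + c^-1) * eps `^ m by apply: le_trans close.
have p2 : 0 <= mubar m * (8 * mubar m / c) `^ m * eps `^ m.
  by rewrite !mulr_ge0 ?powR_ge0 ?(ltW (mubar_gt0 hm)).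
have p3 : 0 <= K / c * eps `^ m by apply: le_trans var.
rewrite /mean_constant; move: close var; rewrite !ler_norml mX => /andP[a1 a2] /andP[a3 a4].
have -> (e a b k d : R) : (a + b + 5 * k / d) * e = a * e + b * e + 5 * (k / d * e) by ring.
move: We; rewrite (_ : 2 * K / c * eps `^ m = 2 * (K / c * eps `^ m)); last by ring.
move: (K / c * _) (mubar m * _ * _) (2 * B * K * _ * _) p1 p2 p3 a1 a2 a3 a4 ends.
by move=> q1 q2 q3 p1 p2 p3 a1 a2 a3 a4 ends We; apply/andP; split; lra.
Qed.

(** The odd and even parts of [W] are compared separately with those of [W0]; negative [x] is
    handled by reflecting [T]. *)
Lemma rescaled_V_close T x : is_S0 m T -> - X <= x <= X ->
  `|W x - W0 m T x| <= (2 * B * K * (1 + c^-1) + mean_constant) * eps `^ m.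
Proof.
move=> hT /andP[x1 x2].
have WE y : W y = (S1 y + mean y) / 2 by rewrite /gap1 /mean; field.
have combine (a b d e p q : R) : `|a - b| <= p -> `|d - e| <= q ->
    `|(a + d) / 2 - 1/2 * (b + e)| <= p + q.
  move=> ab de; have pq : 0 <= p by apply: le_trans ab.
  have qq : 0 <= q by apply: le_trans de.
  move: ab de; rewrite !ler_norml => /andP[? ?] /andP[? ?].
  by apply/andP; split; lra.
rewrite WE (mulrDl _ _ (eps `^ m)) /W0; have [x0|x0] := leP 0 x.
  have xX : 0 <= x <= X by rewrite x0.
  by apply: combine; [exact: gap1_close|exact: mean_close hT xX].
have xX : 0 <= - x <= X by apply/andP; split; lra.
apply: combine; last first.
  by have := mean_close hT xX; rewrite /mean opprK (addrC (W (- x))).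
have := gap1_close (is_S0_reflect hT) xX.
rewrite (is_S0_reflect_derive1 _ hT) opprK /gap1 opprK.
have -> : W x - W (- x) - derive1 T x = - (W (- x) - W x + derive1 T x) by ring.
by rewrite normrN.
Qed.

Lemma rescaled_V_close1 T x : is_S0 m T -> - X <= x <= X ->
  `|W1 x - force m (T x) / 2| <= K * (comparison_rate m * B + 1) * eps `^ (m + 1).
Proof.
move=> hT /andP[x1 x2]; have [x0|x0] := leP 0 x.
  by apply: rescaled_V1_close => //; [rewrite x0|left].
have xX : 0 <= - x <= X by apply/andP; split; lra.
have := rescaled_V1_close (is_S0_reflect hT) xX (or_intror erefl).
by rewrite opprK.
Qed.

End convergence.

(** * Crude bounds for waves of arbitrary tip *)

Section large_tip.
Context {R : realType}.
Variables (m sigma : R) (V r : R -> R).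
Hypothesis hm : 1 < m.
Hypothesis hw : subunit_wave m V r sigma.

(** The prefactor cancels exactly the singular power of [1 - r 0] in the stress. *)
Let stress_tip_le : tip r `^ (m + 1) * stress m r 0 <= 1.
Proof.
have hm' := hm; have e0 := tip_gt0 hw.
have p0 := powR_gt0 (m + 1) e0.
apply: (le_trans (ler_wpM2l (ltW p0) (stress_le r hm 0))).
rewrite powRN -/(tip r); apply: (@le_trans _ _ (m + 1)^-1); last by rewrite invf_le1; lra.
rewrite le_eqVlt; apply/orP; left; apply/eqP; field.
by rewrite !lt0r_neq0//; lra.
Qed.

Lemma rescaled_V1_bound x : `|rescaled_V1 m sigma r x| <= 1.
Proof.
have z := normr0 R.
have s0 y : stress m r y <= stress m r 0 by apply: (stress_antitone hm hw); rewrite z.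
have sp y := stress_ge0 hm hw y.
rewrite /rescaled_V1 normrM (ger0_norm (powR_ge0 _ _)).
apply: le_trans stress_tip_le; rewrite ler_wpM2l ?powR_ge0//.
set a := _ * x; have := s0 a; have := sp a; have := s0 (a - 1); have := sp (a - 1).
by move=> ? ? ? ?; rewrite ler_norml; apply/andP; split; lra.
Qed.

(** The square of [mu * V 0] splits as [eps * V 0 <= 2] times [eps^(m + 1) * sigma * V 0 <= 1]. *)
Lemma rescaled_V_bound x : `|rescaled_V m sigma V r x| <= 2 / tip r.
Proof.
have hm' := hm; have e0 := tip_gt0 hw; have e1 := tip_le1 hw; have u0 := width_gt0 hw.
have Vp y : 0 <= V y by case: hw => _ [].
have V1 : V (- (1/2) + width m sigma r * x) <= V 0.
  by apply: (wave_V_antitone hw); rewrite normr0.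
have V2 : V 0 <= 2 by have := wave_V0_le hm hw; move: e0; rewrite /tip; lra.
rewrite /rescaled_V ger0_norm; last by rewrite mulr_ge0// divr_ge0// ltW.
rewrite mulrAC ler_wpM2r ?invr_ge0 ?(ltW e0)//.
apply: (@le_trans _ _ (width m sigma r * V 0)); first by rewrite ler_wpM2l// ltW.
rewrite -(@ler_pXn2r _ 2)// ?nnegrE//; last by rewrite mulr_ge0// ltW.
rewrite exprMn (width_sqr hw) (_ : m + 2 = m + 1 + 1); last by ring.
rewrite (tip_powD hw).
have := ler_wpM2l (powR_ge0 (tip r) (m + 1)) (wave_sigmaV0_le hm hw).
move=> /le_trans/(_ stress_tip_le) => H.
have H0 : 0 <= tip r `^ (m + 1) * (sigma * V 0).
  by rewrite mulr_ge0 ?powR_ge0// mulr_ge0// ltW//; case: hw => -[].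
rewrite (_ : _ * V 0 ^+ 2 = (tip r * V 0) * (tip r `^ (m + 1) * (sigma * V 0))); last by ring.
have H1 : tip r * V 0 <= 2 by have := Vp 0; nra.
have H2 : 0 <= tip r * V 0 by rewrite mulr_ge0// ltW.
by nra.
Qed.

End large_tip.

(** * One constant for small and large tips *)

Section uniform_estimate.
Context {R : realType}.
Implicit Types (m sigma x : R) (V r T : R -> R).

Lemma rescaled_wave_estimate m : 1 < m -> exists C : R,
  forall sigma V r T x, subunit_wave m V r sigma -> is_S0 m T ->
  - (1 / (2 * width m sigma r)) <= x <= 1 / (2 * width m sigma r) ->
  `|rescaled_V m sigma V r x - W0 m T x| <= C * tip r `^ m /\
  `|rescaled_V1 m sigma r x - force m (T x) / 2| <= C * tip r `^ (m + 1).
Proof.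
move=> hm; pose c := force m (1/2) / 2; pose K := defect_bound m; pose b := mubar m.
have c0 : 0 < c by rewrite divr_gt0// force_gt0//; lra.
have b0 : 0 < b := mubar_gt0 hm.
have K0 : 0 < K.
  rewrite /K /defect_bound mulr_gt0 ?invr_gt0; try lra.
  by have := powR_ge0 (1/4 : R) (- (m + 1)); lra.
(* Below this threshold, which depends on [m] alone, the three smallness conditions hold. *)
pose e0 := Num.min (1/6) (Num.min (c / (2 * K)) (1 / (8 * b))).
have e00 : 0 < e0.
  rewrite /e0 !lt_min; apply/and3P; split; first by lra.
    by apply: divr_gt0 => //; apply: mulr_gt0.
  by apply: divr_gt0 => //; apply: mulr_gt0.
pose C1 := 2 * comparison_constant m * K * (1 + c^-1) + mean_constant m.
pose C2 := K * (comparison_rate m * comparison_constant m + 1).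
pose C3 := (2 / e0 + b) * e0 `^ (- m).
pose C4 := 2 * e0 `^ (- (m + 1)).
exists (Num.max (Num.max C1 C2) (Num.max C3 C4)) => sigma V r T x hw hT xX.
have t0 := tip_gt0 hw.
have weak (a C' p : R) : a <= C' * tip r `^ p ->
    C' <= Num.max (Num.max C1 C2) (Num.max C3 C4) ->
    a <= Num.max (Num.max C1 C2) (Num.max C3 C4) * tip r `^ p.
  by move=> aC CC; apply: (le_trans aC); rewrite ler_wpM2r ?powR_ge0.
have [small|large] := leP (tip r) e0.
  move: small; rewrite !le_min => /and3P[s1 s2 s3].
  have K2 : 0 < 2 * K by apply: mulr_gt0.
  have b8 : 0 < 8 * b by apply: mulr_gt0.
  have s2' : 2 * K * tip r <= c.
    by move: s2; rewrite (ler_pdivlMr _ _ K2) (mulrC (tip r)).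
  have s3' : 8 * b * tip r <= 1.
    by move: s3; rewrite (ler_pdivlMr _ _ b8) (mulrC (tip r)).
  split; [apply: (@weak _ C1)|apply: (@weak _ C2)]; try by rewrite !le_max lexx ?orbT.
  - exact: (rescaled_V_close hm hw s1 s2' s3' hT xX).
  - exact: (rescaled_V_close1 hm hw s1 s2' hT xX).
have pow (p : R) : 0 <= p -> 1 <= e0 `^ (- p) * tip r `^ p.
  move=> p0; rewrite powRN mulrC ler_pdivlMr ?powR_gt0// mul1r.
  by apply: ge0_ler_powR; rewrite ?nnegrE// ltW.
have [T0 T1] := is_S0_bounds x hm hT.
split; [apply: (@weak _ C3)|apply: (@weak _ C4)]; try by rewrite !le_max lexx ?orbT.
- rewrite /C3 -mulrA.
  apply: (@le_trans _ _ (2 / e0 + b)); last first.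
    rewrite ler_peMr//; first by rewrite addr_ge0 ?divr_ge0// ltW.
    by apply: pow; lra.
  apply: (le_trans (ler_normB _ _)); apply: lerD.
    apply: (le_trans (rescaled_V_bound hm hw x)).
    by rewrite ler_wpM2l// lef_pV2 ?posrE// ltW.
  rewrite /W0 -/b; move: T1 b0; rewrite -/b !ler_norml => /andP[? ?] ?.
  by apply/andP; split; lra.
- rewrite /C4 -mulrA.
  apply: (@le_trans _ _ 2); last by rewrite ler_peMr//; apply: pow; lra.
  apply: (le_trans (ler_normB _ _)).
  have := rescaled_V1_bound hm hw x.
  have f0 := force_ge0 (T x) hm.
  have : force m (T x) <= 2.
    apply: (@le_trans _ _ (force m 0)); first by apply: force_antitone; lra.
    by rewrite force0 ler_pdivrMr; lra.
  by rewrite (ger0_norm (_ : 0 <= force m (T x) / 2)); lra.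
Qed.

End uniform_estimate.

(** * Transfer to high-energy families and to suprema *)

Unset Implicit Arguments.

Theorem theorem9 (R : realType) (m : R) (V Rd : R -> R -> R) (sigma : R -> R)
    (S0 : R -> R) (hm : 1 < m) (hfam : high_energy_family m V Rd sigma)
    (hS0 : is_S0 m S0) :
  exists C : R, forall d : R, 0 < d < 1 ->
    (ereal_sup [set (`|Wdelta m V Rd sigma d x - W0 m S0 x|)%:E
               | x in Jdelta m Rd sigma d]
       <= (C * eps_par Rd d `^ m)%:E)%E /\
    (ereal_sup [set (`|(Wdelta m V Rd sigma d)^`()%classic x - (W0 m S0)^`()%classic x|)%:E
               | x in Jdelta m Rd sigma d]
       <= (C * eps_par Rd d `^ (m + 1))%:E)%E.
Proof.
have [C hC] := rescaled_wave_estimate hm; exists C => d hd.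
have [wave [aV ar] normV r01] := hfam.1 d hd.
have hw : subunit_wave m (V d) (Rd d) (sigma d).
  split; [exact: wave|exact: aV|exact: ar|exact: r01|].
  by exists (1 - d); [lra|exact: normV].
have est x (xJ : Jdelta m Rd sigma d x) := hC _ _ _ _ x hw hS0 xJ.
split; apply: ge_ereal_sup => _ [x xJ <-]; rewrite lee_fin.
  exact: (est x xJ).1.
have -> : (Wdelta m V Rd sigma d)^`()%classic x = rescaled_V1 m (sigma d) (Rd d) x.
  by apply: is_derive_derive1; exact: is_derive_rescaled_V.
have -> : (W0 m S0)^`()%classic x = force m (S0 x) / 2.
  apply: is_derive_derive1.
  have := is_deriveZ_fun (1/2) (is_deriveD_fun (is_S0_is_derive2 x hS0)
    (is_derive_cst (mubar m) x 1)).
  by rewrite addr0 (_ : 1/2 * force m (S0 x) = force m (S0 x) / 2)//; field.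
exact: (est x xJ).2.
Qed.
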